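(* If $T$ is any tree, then $\mathcal E\{T\}\rightsquigarrow\mathsf{Trees}$.
   Context: Graphs are finite, undirected, without loops or parallel edges. A graph $H$ is a minor of a graph $G$ if $H$ can be obtained from $G$ by a sequence of zero or more edge deletions, vertex deletions, and edge contractions. $\mathcal E\{T\}$ is the family of all graphs which do not have $T$ as a minor; $\mathsf{Trees}$ is the family of connected, acyclic graphs. For a graph $G=(V,E)$ and a length function $\mathrm{len}:E\to[0,\infty)$, $d_{\mathrm{len}}$ denotes the induced shortest-path pseudometric on $V$. By convention, $d_{\mathrm{len}}(x,y)=0$ may occur for $x\ne y$, and if $G$ is disconnected there are pairs with $d_{\mathrm{len}}(x,y)=\infty$; both possibilities are allowed. A pseudometric $d$ on $V$ is supported on $G$ if $d=d_{\mathrm{len}}$ for some such $\mathrm{len}$, and is supported on a family of graphs if it is supported on some member of the family. The words ''metric'' and ''metric space'' are used with these conventions. If $(X,d)$ is a finite metric space and $\mathcal Y$ is a family of finite metric spaces, $(X,d)$ admits a stochastic $D$-embedding into $\mathcal Y$ if there exist a randomly chosen metric space $(Y,d_Y)\in\mathcal Y$ and a randomly chosen mapping $F:X\to Y$ such that (i) with probability one, for every $x,y\in X$, $d_Y(F(x),F(y))\ge d(x,y)$; and (ii) for every $x,y\in X$, $\mathbb E[d_Y(F(x),F(y))]\le D\cdot d(x,y)$. For graph families $\mathcal F,\mathcal G$, write $\mathcal F\rightsquigarrow\mathcal G$ if there exists $D<\infty$ such that every metric supported on $\mathcal F$ admits a stochastic $D$-embedding into the family of metrics supported on $\mathcal G$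.
   Formalization: The graphs in E{T} supporting the source metrics are assumed connected; a disconnected graph (e.g. two isolated vertices, T an edge) has an infinite distance, which no metric supported on a connected tree with finite lengths can dominate, so the claim fails for every such graph. *)

(* Defs.v *)
From HB Require Import structures.
From mathcomp Require Import all_boot all_order all_algebra.
From mathcomp Require Import all_classical all_reals all_analysis.
From mathcomp Require Import measurable_realfun.
Set Implicit Arguments.
Unset Strict Implicit.
Unset Printing Implicit Defensive.
Import Order.TTheory GRing.Theory Num.Theory.
Local Open Scope classical_set_scope.
Local Open Scope ring_scope.
Local Open Scope ereal_scope.

Record sgraph := SGraph {
  vertex :> finType;
  adj : rel vertex;
  adj_sym : symmetric adj;
  adj_irr : irreflexive adj }.

Definition graph_family := sgraph -> Prop.

Definition edge_set (G : sgraph) : {set {set G}} :=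
  [set A : {set G} | [exists x, exists y, adj x y && (A == [set x; y]%SET)]]%SET.

Definition iso (G H : sgraph) : Prop :=
  exists2 f : G -> H, bijective f & forall x y, adj (f x) (f y) = adj x y.

Section MinorOperations.
Variable G : sgraph.
Implicit Types u v : G.

Definition del_vertex_adj v : rel {x : G | x != v} :=
  fun x y => adj (val x) (val y).

Lemma del_vertex_sym v : symmetric (@del_vertex_adj v).
Proof. by move=> x y; exact: adj_sym. Qed.

Lemma del_vertex_irr v : irreflexive (@del_vertex_adj v).
Proof. by move=> x; exact: adj_irr. Qed.

Definition del_vertex v := SGraph (@del_vertex_sym v) (@del_vertex_irr v).

Definition del_edge_adj u v : rel G :=
  fun x y => adj x y && ([set x; y]%SET != [set u; v]%SET).

Lemma del_edge_sym u v : symmetric (del_edge_adj u v).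
Proof. by move=> x y; rewrite /del_edge_adj adj_sym finset.setUC. Qed.

Lemma del_edge_irr u v : irreflexive (del_edge_adj u v).
Proof. by move=> x; rewrite /del_edge_adj adj_irr. Qed.

Definition del_edge u v := SGraph (del_edge_sym u v) (del_edge_irr u v).

(* Contracting uv identifies v with u, so that v disappears from the vertex
   set; the resulting loops and parallel edges are discarded. *)
Definition merge u v (x : G) : G := if x == v then u else x.

Definition contract_adj u v : rel {x : G | x != v} :=
  fun x y => (x != y) &&
    [exists x', exists y',
       [&& merge u v x' == val x, merge u v y' == val y & adj x' y']].

Lemma contract_sym u v : symmetric (@contract_adj u v).
Proof.
suff sub x y : @contract_adj u v x y -> @contract_adj u v y x.
  by move=> x y; apply/idP/idP; exact: sub.
case/andP=> xy /existsP[x' /existsP[y' /and3P[ex ey axy]]].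
apply/andP; split; first by rewrite eq_sym.
by apply/existsP; exists y'; apply/existsP; exists x'; rewrite ex ey adj_sym.
Qed.

Lemma contract_irr u v : irreflexive (@contract_adj u v).
Proof. by move=> x; rewrite /contract_adj eqxx. Qed.

Definition contract u v := SGraph (@contract_sym u v) (@contract_irr u v).

End MinorOperations.

Inductive minor (H : sgraph) : sgraph -> Prop :=
| minor_iso (G : sgraph) : iso H G -> minor H G
| minor_del_vertex (G : sgraph) (v : G) : minor H (del_vertex v) -> minor H G
| minor_del_edge (G : sgraph) (u v : G) :
    adj u v -> minor H (del_edge u v) -> minor H G
| minor_contract (G : sgraph) (u v : G) :
    adj u v -> minor H (contract u v) -> minor H G.

Definition excluding (T : sgraph) : graph_family := fun G => ~ minor T G.

Definition connected_graph : graph_family :=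
  fun G => forall x y : G, connect (@adj G) x y.

(* An edge xy yields the duplicate-free cyclic sequence [:: x; y], which is not
   a cycle of the graph; hence the bound on the size. *)
Definition acyclic_graph : graph_family :=
  fun G => forall p : seq G, (2 < size p)%N -> ~ ucycle (@adj G) p.

Definition trees : graph_family :=
  fun G => connected_graph G /\ acyclic_graph G.

Record fin_metric (R : realType) := FinMetric {
  point :> finType;
  dist : point -> point -> \bar R;
  dist_ge0 : forall x y, 0 <= dist x y;
  distxx : forall x, dist x x = 0;
  dist_sym : forall x y, dist x y = dist y x;
  dist_triangle : forall x y z, dist x z <= dist x y + dist y z }.

Definition length_function (R : realType) (G : sgraph) (len : {set G} -> R) :=
  forall A : {set G}, A \in edge_set G -> (0 <= len A)%R.

(* The walk is x followed by the items of p; zip (x :: p) p lists its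
   consecutive pairs of vertices. *)
Definition walk_length (R : realType) (G : sgraph) (len : {set G} -> R)
    (x : G) (p : seq G) : R :=
  (\sum_(uv <- zip (x :: p) p) len [set uv.1; uv.2]%SET)%R.

(* The infimum is +oo when no walk joins x to y. *)
Definition path_dist (R : realType) (G : sgraph) (len : {set G} -> R)
    (x y : G) : \bar R :=
  ereal_inf [set (walk_length len x p)%:E |
             p in [set p : seq G | path (@adj G) x p /\ last x p = y]].

Definition supported_on (R : realType) (F : graph_family) (M : fin_metric R) :=
  exists (e : rel M) (e_sym : symmetric e) (e_irr : irreflexive e),
    let G := SGraph e_sym e_irr in
    F G /\ exists len : {set G} -> R,
      length_function len /\
      forall x y : M, dist x y = path_dist len (x : G) (y : G).

(* The random pair (Y, F) lives on an arbitrary probability space; since only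
   distances between images are used, these are what must be measurable. *)
Definition stochastic_embedding (R : realType) (D : R) (X : fin_metric R)
    (YY : fin_metric R -> Prop) : Prop :=
  exists (disp : measure_display) (Omega : measurableType disp)
         (P : probability Omega R)
         (Y : Omega -> fin_metric R) (F : forall w, X -> Y w),
    [/\ forall w, YY (Y w),
        forall x y, measurable_fun setT (fun w => dist (F w x) (F w y)),
        {ae P, forall w, forall x y, dist x y <= dist (F w x) (F w y)} &
        forall x y, \int[P]_w dist (F w x) (F w y) <= D%:E * dist x y].

Definition embeds_into (R : realType) (F G : graph_family) : Prop :=
  exists D : R, forall X : fin_metric R,
    supported_on F X -> stochastic_embedding D X (supported_on G).

(* Main.v *)
(** The proof goes through pathwidth.  A graph without the tree T as a minor has
    a path decomposition with bags of size at most k = |T| (Bienstock, Robertson,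
    Seymour and Thomas; we follow Diestel's short proof).  The embedding is then
    built by induction on k.  In a connected graph, a shortest path P from the
    first to the last bag meets every bag, so the graph minus P has bags of size
    at most k - 1 and embeds into a random forest by induction.  Let d be the
    distance to P.  Cut the forest at random so that an edge of length l at
    distance d from P is cut with probability O(l / d), while each piece sees
    only a bounded variation of d and has diameter O(d), and hang every piece on
    a nearest point of P by an edge of length d.  A cut edge is stretched to O(d),
    so its expected stretch stays bounded; only the scale d matters at each
    point, which is why no logarithmic factor appears. *)
Require Import Defs.
From HB Require Import structures.
From mathcomp Require Import all_boot all_order all_algebra.
From mathcomp Require Import all_classical all_reals all_analysis.
From mathcomp Require Import zify lra.
(* Restores the lemma names that classical_sets shadows. *)
From mathcomp Require Import fintype finset.
Set Implicit Arguments.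
Unset Strict Implicit.
Unset Printing Implicit Defensive.
Import Order.TTheory GRing.Theory Num.Theory.
Local Open Scope set_scope.

(** * Linkages *)

(** [P] has to be geodesic for the detour through it to be cheap: the tree reproduces distances
    along [P] exactly, so the ends of an edge of length [l], once sent to [P] within [O(d)], lie
    there at most [l + O(d)] apart. All randomness is finite: a forest is drawn uniformly from a
    finite set together with an integer offset below some [N], so expectations are finite sums. The
    integral of the cutting density is therefore rounded to integers. Edge lengths may vanish, and
    so may [d] off [P]; hence the bounds on the rounded integral are multiplied out by [d]. One
    level of the induction turns the stretch [D] into [97 * D + 7], so the final constant depends on
    [|T|] alone. *)

Section Hall.
Variable V : finType.

Definition nbhd (N : rel V) (S : {set V}) : {set V} :=
  [set y | [exists x in S, N x y]]%SET.

Lemma nbhdP (N : rel V) (S : {set V}) y :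
  reflect (exists2 x, x \in S & N x y) (y \in nbhd N S).
Proof. by rewrite inE; exact: exists_inP. Qed.

(** Induction on the size of [L]. A nonempty proper subset with no more neighbours than elements is
    matched into its neighbourhood, and the rest of [L] outside it. If there is none, every nonempty
    proper subset has a neighbour to spare and the first edge can be chosen at will. *)
Lemma hall (N : rel V) (L : {set V}) :
  (forall S : {set V}, S \subset L -> #|S| <= #|nbhd N S|) ->
  exists2 f : V -> V, {in L &, injective f} & {in L, forall x, N x (f x)}.
Proof.
have [n] := ubnP #|L|; elim: n N L => // n IHn N L ltLn hallL.
have [->|/set0Pn[x Lx]] := eqVneq L finset.set0.
  by exists id => x; rewrite inE.
have [[S [pS S0 cS]]|noS] := pselect (exists S : {set V},
    [/\ S \proper L, S != finset.set0 & #|nbhd N S| <= #|S|]).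
  have sSL := proper_sub pS.
  have [|S1 sS1|f1 inj1 N1] := IHn N S.
  - by rewrite -ltnS (leq_trans _ ltLn) // ltnS proper_card.
  - by apply: hallL; exact: subset_trans sS1 sSL.
  pose N' x y := N x y && (y \notin nbhd N S).
  have [||f2 inj2 N2] := IHn N' (L :\: S)%SET.
  - rewrite -ltnS (leq_trans _ ltLn) // ltnS proper_card //.
    case/set0Pn: S0 => s Ss; apply/properP; split; first exact: subsetDl.
    by exists s; rewrite ?inE ?Ss // (subsetP sSL).
  - move=> S' /subsetDP[sS'L dS'].
    have: #|(S :|: S')%SET| <= #|nbhd N (S :|: S')%SET|.
      by apply: hallL; rewrite subUset sSL.
    rewrite cardsU (disjoint_setI0 _) 1?disjoint_sym // cards0 subn0 => le1.
    suff le2 : #|nbhd N (S :|: S')%SET| <= #|nbhd N S| + #|nbhd N' S'|.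
      by rewrite -(leq_add2l #|S|) (leq_trans le1) // (leq_trans le2) // leq_add2r.
    rewrite -cardsUI (leq_trans _ (leq_addr _ _)) // subset_leq_card //.
    apply/subsetP => y /nbhdP[z /setUP[Sz|Sz] Nzy]; rewrite inE.
      by apply/orP; left; apply/nbhdP; exists z.
    have [//|nSy /=] := boolP (y \in nbhd N S).
    by apply/nbhdP; exists z; rewrite // /N' Nzy.
  exists (fun x => if x \in S then f1 x else f2 x) => [y z Ly Lz|y Ly].
    have inD u : u \in L -> u \notin S -> u \in (L :\: S)%SET.
      by move=> Lu Su; rewrite inE Su.
    case: ifPn => Sy; case: ifPn => Sz e.
    + exact: inj1.
    + case/andP: (N2 _ (inD _ Lz Sz)) => _ /negP[]; rewrite -e.
      by apply/nbhdP; exists y => //; exact: N1.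
    + case/andP: (N2 _ (inD _ Ly Sy)) => _ /negP[]; rewrite e.
      by apply/nbhdP; exists z => //; exact: N1.
    + by apply: inj2 => //; exact: inD.
  case: ifPn => Sy; first exact: N1.
  by have /andP[] : N' y (f2 y) by apply: N2; rewrite inE Sy.
have /card_gt0P[y /nbhdP[_ /set1P-> Nxy]] : 0 < #|nbhd N [set x]%SET|.
  by rewrite (leq_trans _ (hallL _ _)) ?cards1 ?sub1set.
pose N' u v := N u v && (v != y).
have [||f inj1 N1] := IHn N' (L :\ x)%SET.
- by rewrite -ltnS (leq_trans _ ltLn) // ltnS [X in _ < X](cardsD1 x) Lx.
- move=> S sS; have [->|S0] := eqVneq S finset.set0; first by rewrite cards0.
  have ltS : #|S| < #|nbhd N S|.
    rewrite ltnNge; apply/negP => le; apply: noS; exists S; split=> //.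
    by apply: sub_proper_trans sS _; rewrite properD1.
  have : nbhd N S \subset (y |: nbhd N' S)%SET.
    apply/subsetP => z /nbhdP[u Su Nuz]; rewrite !inE.
    by have [//|zy] := eqVneq z y; apply/exists_inP; exists u; rewrite // /N' Nuz.
  move/subset_leq_card; rewrite cardsU1 => le.
  by rewrite -ltnS (leq_trans ltS) // (leq_trans le) // -add1n leq_add2r; case: (_ \notin _).
exists (fun u => if u == x then y else f u) => [u v Lu Lv|u Lu].
  have inD w : w \in L -> w != x -> w \in (L :\ x)%SET by move=> Lw wx; rewrite !inE wx.
  case: eqVneq => [->|ux]; case: eqVneq => [->|vx] // e.
  - by case/andP: (N1 _ (inD _ Lv vx)); rewrite -e eqxx.
  - by case/andP: (N1 _ (inD _ Lu ux)); rewrite e eqxx.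
  - by apply: inj1 => //; exact: inD.
case: eqVneq => [->//|ux].
by have /andP[] : N' u (f u) by apply: N1; rewrite !inE ux.
Qed.

End Hall.

(** * Connected sets, boundaries and Menger's theorem *)

Section Connected.
Variables (V : finType) (e : rel V).
Hypothesis e_sym : symmetric e.
Implicit Types Q S X Y Z : {set V}.

Definition closed_in Q S :=
  forall u v, u \in S -> u \in Q -> v \in Q -> e u v -> v \in S.

(** Connectedness without paths; the empty set counts as connected. *)
Definition conn Q :=
  forall S x, x \in S -> x \in Q -> closed_in Q S -> Q \subset S.

Lemma conn_root Q a : a \in Q ->
  (forall S, a \in S -> closed_in Q S -> Q \subset S) -> conn Q.
Proof.
move=> Qa connQ S x Sx Qx clS; have [Sa|nSa] := boolP (a \in S); first exact: connQ.
suff /subsetP/(_ x Qx) : Q \subset ~: S by rewrite inE Sx.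
apply: connQ => [|u v]; rewrite !inE // => nSu Qu Qv euv.
by apply: contra nSu => Sv; apply: clS Sv Qv Qu _; rewrite e_sym.
Qed.

Lemma conn1 x : conn [set x].
Proof. by move=> S y Sy /set1P<- _; rewrite sub1set. Qed.

Lemma connU Q Q' x : x \in Q -> x \in Q' -> conn Q -> conn Q' -> conn (Q :|: Q').
Proof.
move=> Qx Q'x cQ cQ'; apply: (@conn_root _ x) => [|S Sx clS]; first by rewrite inE Qx.
rewrite subUset (cQ _ x) ?(cQ' _ x) // => u v Su Qu Qv;
  by apply: clS; rewrite // inE ?Qu ?Qv ?orbT.
Qed.

(** Read for both orders of an edge, this says that the intervals from [l] to [r] of its two ends
    meet. *)
Definition overlaps Q (l r : V -> nat) :=
  forall x y, x \in Q -> y \in Q -> e x y -> l x <= r y.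

(** Otherwise the vertices whose interval ends before [t] form a set closed in [Q], because no edge
    can jump over [t]. *)
Lemma conn_cross Q l r u v t : conn Q -> overlaps Q l r ->
  u \in Q -> v \in Q -> l u <= t <= r v -> exists2 q, q \in Q & l q <= t <= r q.
Proof.
move=> cQ ov Qu Qv /andP[lut trv]; apply: contrapT => noq.
have noq' q : q \in Q -> l q <= t -> r q < t.
  by move=> Qq lq; rewrite ltnNge; apply/negP => tq; apply: noq; exists q; rewrite ?lq.
suff /subsetP/(_ v Qv) : Q \subset [set x | r x < t] by rewrite inE ltnNge trv.
apply: (cQ _ u) => //; first by rewrite inE noq'.
move=> a b; rewrite !inE => rat Qa Qb eab; apply: noq' => //.
by rewrite (leq_trans (ov b a _ _ _) (ltnW rat)) // e_sym.
Qed.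

Definition bdry X : {set V} := [set x in X | [exists y, e x y && (y \notin X)]].

Lemma bdryP X x :
  reflect (x \in X /\ exists2 y, e x y & y \notin X) (x \in bdry X).
Proof.
rewrite inE; apply: (iffP andP) => -[Xx].
  by case/existsP => y /andP[? ?]; split=> //; exists y.
by case=> y exy nXy; split=> //; apply/existsP; exists y; rewrite exy.
Qed.

Lemma bdry_sub X : bdry X \subset X.
Proof. by apply/subsetP => x /bdryP[]. Qed.

Lemma bdry_out X x y : x \in X -> x \notin bdry X -> e x y -> y \in X.
Proof.
move=> Xx nx exy; apply: contraNT nx => nXy; apply/bdryP; split=> //.
by exists y.
Qed.

(** Links are connected sets instead of paths, since they are only ever contracted or added to
    branch sets. *)
Definition linked Z Y (Q : V -> {set V}) := [/\
  forall a, a \in bdry Z -> [/\ a \in Q a, conn (Q a), Q a \subset Y &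
    exists2 w, w \in Q a & w \in bdry Y],
  forall a w, a \in bdry Z -> w \in Q a -> w \in Z -> w = a &
  forall a b w, a \in bdry Z -> b \in bdry Z -> w \in Q a -> w \in Q b -> a = b].

(* A set version of Menger's theorem.  By Hall's theorem the hypothesis yields
   an injection f from the non-boundary vertices of Y outside the interior of Z
   into Y minus Z, moving vertices along edges; its orbits are the links. *)
Lemma linkage Z Y : Z \subset Y ->
  (forall Z', Z \subset Z' -> Z' \subset Y -> #|bdry Z| <= #|bdry Z'|) ->
  exists Q : V -> {set V}, linked Z Y Q.
Proof.
move=> sZY minZ.
pose N x y := ((y == x) || e x y) && (y \notin Z).
pose L := (bdry Z :|: (Y :\: Z)) :\: bdry Y.
have LP x : reflect [/\ x \in Y, x \notin bdry Y & (x \in Z) ==> (x \in bdry Z)] (x \in L).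
  rewrite in_setD in_setU in_setD; apply: (iffP andP) => [[nB h]|[Yx nB h]]; split=> //.
  - by case/orP: h => [/bdryP[/(subsetP sZY)]|/andP[]].
  - by apply/implyP => Zx; case/orP: h; rewrite ?Zx.
  - by rewrite Yx andbT; case: (x \in Z) h; rewrite ?orbT //= => ->.
have LY x y : x \in L -> e x y -> y \in Y by case/LP => Yx nbx _; exact: bdry_out.
have [S sSL|f injf Nf] := @hall _ N L.
  (* Hall's condition comes from minimality applied to [Z :|: M]: this set contains [S] and all its
     neighbours, so passing from [Z] to it removes [S] from the boundary and adds at most [M]. *)
  pose M := nbhd N S.
  have sM x : x \in S -> x \in Z :|: M.
    move=> Sx; rewrite inE; case: (boolP (x \in Z)) => //= nZx.
    by apply/nbhdP; exists x => //; rewrite /N eqxx.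
  have nM x y : x \in S -> e x y -> y \in Z :|: M.
    move=> Sx exy; rewrite inE; case: (boolP (y \in Z)) => //= nZy.
    by apply/nbhdP; exists x => //; rewrite /N exy orbT.
  have MZ : [disjoint M & Z].
    by rewrite disjoint_subset; apply/subsetP => x /nbhdP[y _ /andP[]].
  have sSM : S \subset bdry Z :|: M.
    apply/subsetP => x Sx; have := sM x Sx; rewrite !in_setU => /orP[Zx|->]; last by rewrite orbT.
    by case/LP: (subsetP sSL _ Sx) => _ _; rewrite Zx /= => ->.
  have ZM : #|bdry Z| <= #|bdry (Z :|: M)|.
    apply: minZ; rewrite ?subsetUl // subUset sZY; apply/subsetP => y /nbhdP[x Sx].
    have Lx := subsetP sSL _ Sx; case/andP => /orP[/eqP->|exy] _; last exact: LY exy.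
    by case/LP: Lx.
  have : bdry (Z :|: M) \subset (bdry Z :|: M) :\: S.
    apply/subsetP => x /bdryP[ZMx [y exy nZMy]]; rewrite !in_setD !in_setU.
    apply/andP; split; first by apply: contra nZMy => Sx; exact: nM exy.
    move: ZMx; rewrite in_setU; case: (boolP (x \in M)) => [_|_]; rewrite ?orbT // !orbF => Zx.
    by apply/bdryP; split=> //; exists y => //; apply: contra nZMy; rewrite inE => ->.
  move/subset_leq_card; rewrite cardsD (setIidPr sSM) => le1.
  have le2 : #|bdry Z :|: M| <= #|bdry Z| + #|M|.
    by rewrite -cardsUI leq_addr.
  have := subset_leq_card sSM; move: ZM le1 le2; rewrite -/M; lia.
pose val n a := forall m, m < n -> iter m f a \in L.
pose Q a := [set w | `[< exists2 n, val n a & w = iter n f a >] ].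
have QP a w : reflect (exists2 n, val n a & w = iter n f a) (w \in Q a).
  by rewrite inE; exact: asboolP.
have Qa a : a \in Q a by apply/QP; exists 0.
have Qf a w : w \in Q a -> w \in L -> f w \in Q a.
  move=> /QP[n vn ->] Lw; apply/QP; exists n.+1 => // m; rewrite ltnS leq_eqVlt.
  by case/orP => [/eqP->//|]; exact: vn.
have fY x : x \in L -> f x \in Y.
  move=> Lx; case/andP: (Nf _ Lx) => /orP[/eqP->|/(LY _ _ Lx)//] _.
  by case/LP: Lx.
have fZ x : x \in L -> f x \notin Z by move=> Lx; case/andP: (Nf _ Lx).
(* Two orbits that meet are traced back by injectivity of [f]; they reach their starts together,
   since [f] takes no value in [Z]. *)
have disj n m a b : a \in bdry Z -> b \in bdry Z -> val n a -> val m b ->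
    iter n f a = iter m f b -> a = b /\ n = m.
  move=> Aa Ab; elim: n m => [|n IHn] [|m] //= va vb eab.
  - by case/negP: (fZ _ (vb m (ltnSn m))); rewrite -eab (subsetP (bdry_sub _)).
  - by case/negP: (fZ _ (va n (ltnSn n))); rewrite eab (subsetP (bdry_sub _)).
  have [|||-> ->//] := IHn m.
  - by move=> i lti; apply: va; exact: ltnW.
  - by move=> i lti; apply: vb; exact: ltnW.
  by apply: injf eab; [exact: va|exact: vb].
have QY a : a \in bdry Z -> Q a \subset Y.
  move=> /bdryP[Za _]; apply/subsetP => _ /QP[[|n] vn ->]; first exact: (subsetP sZY).
  by apply: fY; exact: vn.
exists Q; split=> [a Aa|a w Aa|a b w Aa Ab].
- split=> //; last 1 first.
  + apply: contrapT => noB.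
    (* An orbit avoiding [bdry Y] would stay in [L], and [f] would inject this finite set into
       itself minus [a]. *)
    have QL w : w \in Q a -> w \in L.
      move=> Qw; apply/LP; split; first exact: (subsetP (QY a Aa)).
        by apply/negP => Bw; apply: noB; exists w.
      apply/implyP => Zw; case/QP: Qw => -[|n] vn ew; first by rewrite ew.
      by move: Zw; rewrite ew (negbTE (fZ _ (vn _ (ltnSn n)))).
    have : f @: Q a \subset Q a :\ a.
      apply/subsetP => _ /imsetP[w Qw ->]; rewrite in_setD1 Qf ?QL // andbT.
      by apply: contraNneq (fZ _ (QL _ Qw)) => ->; rewrite (subsetP (bdry_sub _)).
    move/subset_leq_card; rewrite card_in_imset; last by move=> x y /QL Lx /QL Ly; exact: injf.
    by rewrite [X in X <= _](cardsD1 a) Qa ltnn.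
  + apply: (conn_root (Qa a)) => S Sa clS; apply/subsetP => w /QP[n vn ->].
    elim: n vn => // n IHn vn.
    have vn' : val n a by move=> i lti; apply: vn; exact: ltnW.
    have Qn : iter n f a \in Q a by apply/QP; exists n.
    have Ln := vn _ (ltnSn n); case/andP: (Nf _ Ln) => /orP[/eqP/= ->|en] _; first exact: IHn.
    by apply: clS en => //; [exact: IHn|exact: Qf].
  + exact: QY.
- case/QP => -[|n] vn -> //; by rewrite (negbTE (fZ _ (vn _ (ltnSn n)))).
- case/QP=> n vn -> /QP[m vm] /disj[] //.
Qed.

End Connected.

(** * Excluding a tree bounds the pathwidth *)

Section Intervals.
Variables (V : finType) (e : rel V).
Hypothesis e_sym : symmetric e.
Implicit Types (S X Y Z : {set V}) (l r : V -> nat).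

Definition bag X l r t : {set V} := [set x in X | l x <= t <= r x].

(* The bags of [l] and [r] form a path decomposition of the subgraph induced
   by [X], of width less than [k]. *)
Definition interval_rep k X l r := [/\
  forall x, x \in X -> l x <= r x, overlaps e X l r & forall t, #|bag X l r t| <= k].

(* The decomposition can be continued outside [X]: its last bag contains the
   boundary. *)
Definition extendable k X := exists l r N, [/\ interval_rep k X l r,
  forall x, x \in X -> r x <= N & forall x, x \in bdry e X -> r x = N].

(** Each link is contracted onto its start: a boundary vertex of [Z] receives the hull of the
    intervals in its link. By [conn_cross] the link meets every bag of that hull, so disjointness of
    the links injects new bags into old ones. Reaching [bdry Y] puts the vertex into the last
    bag. *)
Lemma extendable_linked k Z Y (Q : V -> {set V}) :
  Z \subset Y -> linked e Z Y Q -> extendable k Y -> extendable k Z.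
Proof.
move=> sZY [Q1 Q2 Q3] [l [r [N [[lr ov bags] rN rB]]]].
pose P z := if z \in bdry e Z then Q z else [set z].
have Pz z : z \in P z by rewrite /P; case: ifPn => [/Q1[]|_] //; rewrite set11.
have PY z : z \in Z -> P z \subset Y.
  by move=> Zz; rewrite /P; case: ifPn => [/Q1[]|_] //; rewrite sub1set (subsetP sZY).
have cP z : conn e (P z) by rewrite /P; case: ifPn => [/Q1[]|_] //; exact: conn1.
have dP z z' w : z \in Z -> z' \in Z -> w \in P z -> w \in P z' -> z = z'.
  rewrite /P => Zz Zz'; case: ifPn => Bz; case: ifPn => Bz'.
  - exact: Q3.
  - by move=> Qw /set1P ew; rewrite -(Q2 z w) // ew.
  - by move=> /set1P ew Qw; rewrite -(Q2 z' w) // ew.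
  - by move=> /set1P-> /set1P.
pose u z := [arg min_(q < z in P z) l q].
pose v z := [arg max_(q > z in P z) r q].
have uP z : u z \in P z /\ forall q, q \in P z -> l (u z) <= l q.
  by rewrite /u; case: arg_minnP.
have vP z : v z \in P z /\ forall q, q \in P z -> r q <= r (v z).
  by rewrite /v; case: arg_maxnP.
exists (fun z => l (u z)), (fun z => r (v z)), N; split; first split.
- move=> z Zz; rewrite (leq_trans ((uP z).2 z _)) // (leq_trans (lr z _)) ?(subsetP sZY) //.
  exact: (vP z).2.
- move=> z z' Zz Zz' ezz'; rewrite (leq_trans ((uP z).2 z _)) //.
  rewrite (leq_trans (ov z z' _ _ _)) ?(subsetP sZY) //; exact: (vP z').2.
- move=> t; pose c z := [pick q in P z | l q <= t <= r q].
  have cB z : z \in bag Z (l \o u) (r \o v) t ->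
      exists q, [/\ c z = Some q, q \in P z & q \in bag Y l r t].
    rewrite inE => /andP[Zz lt]; rewrite /c; case: pickP => [q /andP[Pq ltq]|no].
      by exists q; split=> //; rewrite inE ltq (subsetP (PY z Zz)).
    have ovP : overlaps e (P z) l r.
      by move=> x y Px Py; apply: ov; exact: (subsetP (PY z Zz)).
    have [q Pq ltq] := conn_cross e_sym (cP z) ovP (uP z).1 (vP z).1 lt.
    by have := no q; rewrite /= Pq ltq.
  apply: leq_trans (bags t); rewrite -(card_in_imset (f := c)); last first.
    move=> z z' Bz Bz'; have [q [-> Pq _]] := cB z Bz; have [q' [-> Pq' _]] := cB z' Bz'.
    case=> eq; apply: (dP z z' q) => //; last by rewrite eq.
    - by move: Bz; rewrite inE => /andP[].
    - by move: Bz'; rewrite inE => /andP[].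
  rewrite -[leqRHS](card_imset _ Some_inj); apply/subset_leq_card/subsetP.
  by move=> _ /imsetP[z /cB[q [-> _ Bq]] ->]; exact: imset_f.
- by move=> z Zz; apply: rN; apply: (subsetP (PY z Zz)); exact: (vP z).1.
- move=> z Bz; have Zz := subsetP (bdry_sub e Z) _ Bz.
  apply/eqP; rewrite eqn_leq rN ?(subsetP (PY z Zz)) ?(vP z).1 //=.
  have [_ _ _ [w Qw Bw]] := Q1 z Bz; rewrite -(rB w Bw).
  by apply: (vP z).2; rewrite /P Bz.
Qed.

Lemma extendable0 k : extendable k finset.set0.
Proof.
exists (fun=> 0), (fun=> 0), 0; split=> [|x|x /(subsetP (bdry_sub _ _))]; rewrite ?inE //.
split=> [x|x y|t]; rewrite ?inE //.
rewrite (_ : bag _ _ _ _ = finset.set0) ?cards0 //.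
by apply/setP => x; rewrite !inE.
Qed.

(** A new last bag, at [N.+1], holds [y] and the old boundary, which contains every neighbour of [y]
    in [X]. *)
Lemma extendableU1 k X y : y \notin X -> #|bdry e X| < k ->
  extendable k X -> extendable k (y |: X).
Proof.
move=> nXy ltk [l [r [N [[lr ov bags] rN rB]]]].
pose l' x := if x == y then N.+1 else l x.
pose r' x := if (x == y) || (x \in bdry e X) then N.+1 else r x.
have r'N x : x \in y |: X -> r' x <= N.+1.
  by rewrite /r' in_setU1; case: eqP => //= _ /rN/leqW; case: ifP.
have r'ge x : x \in X -> r x <= r' x.
  by move=> Xx; rewrite /r'; case: ifP => // _; apply: leqW; exact: rN.
have Xny x : x \in X -> (x == y) = false by move=> Xx; apply: contraNF nXy => /eqP<-.
have nb x : x \in X -> e x y -> x \in bdry e X.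
  by move=> Xx exy; apply/bdryP; split=> //; exists y.
exists l', r', N.+1; split=> //; first split.
- move=> x; rewrite in_setU1; have [->|xy] /= := eqVneq x y; first by rewrite /l' /r' eqxx.
  by move=> Xx; rewrite /l' Xny // (leq_trans (lr x Xx)) ?r'ge.
- move=> x z; rewrite !in_setU1; have [->|xy] /= := eqVneq x y.
    have [->|zy] /= := eqVneq z y; first by rewrite /l' /r' eqxx.
    by move=> _ Xz; rewrite e_sym /r' => /(nb z Xz) ->; rewrite orbT /l' eqxx.
  move=> Xx; have [->|zy] /= := eqVneq z y.
    by move=> _ _; rewrite /r' eqxx /l' Xny //= leqW // (leq_trans (lr x Xx)) ?rN.
  by move=> Xz exz; rewrite /l' Xny // (leq_trans (ov x z _ _ _)) ?r'ge.
- move=> t; have [leNt|ltNt] := leqP N.+1 t.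
    apply: leq_trans (_ : #|y |: bdry e X| <= _); last first.
      rewrite cardsU1 -add1n in ltk *; apply: leq_trans ltk.
      by rewrite leq_add2r; case: (_ \notin _).
    apply/subset_leq_card/subsetP => x; rewrite inE !in_setU1 /r'.
    case: eqP => //= _ /andP[Xx /andP[_]]; case: ifP => // _ tr.
    by have := leq_trans leNt (leq_trans tr (rN x Xx)); rewrite ltnn.
  apply: leq_trans (bags t); apply/subset_leq_card/subsetP => x.
  rewrite !inE /l' /r'; case: eqP => /= [_|_ /andP[Xx /andP[-> tr]]].
    by rewrite leqNgt ltNt.
  rewrite Xx /=; case: ifP tr => // Bx _; rewrite rB // -ltnS.
- move=> x /bdryP[]; rewrite in_setU1 /r'; have [//|xy] /= := eqVneq x y.
  move=> Xx [z exz]; rewrite in_setU1 negb_or => /andP[_ nXz].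
  by rewrite (_ : x \in bdry e X) //; apply/bdryP; split=> //; exists z.
Qed.

Lemma extendable_max k m X : extendable k X -> #|bdry e X| <= m ->
  exists Y, [/\ extendable k Y, #|bdry e Y| <= m, X \subset Y &
    forall Z, extendable k Z -> #|bdry e Z| <= m -> Y \subset Z -> Z = Y].
Proof.
move=> exX leX; pose p Y := [&& `[< extendable k Y >], #|bdry e Y| <= m & X \subset Y].
have pX : p X by rewrite /p leX subxx !andbT; exact/asboolP.
case: (arg_maxnP (fun Y => #|Y|) pX) => Y /and3P[/asboolP exY leY sXY] maxY.
exists Y; split=> // Z exZ leZ sYZ; apply/eqP; rewrite eq_sym eqEcard sYZ.
by apply: maxY; rewrite /p leZ (subset_trans sXY sYZ) !andbT; exact/asboolP.
Qed.

End Intervals.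

(** Two neighbours of [v] in [S] would be joined by a path inside [S], closing a cycle through [v].
    This lets a tree be built up by adding one leaf at a time. *)
Lemma tree_next_vertex (T : sgraph) (S : {set T}) : trees T ->
  conn (@adj T) S -> S != finset.set0 -> S != [set: T] ->
  exists v s, [/\ v \notin S, s \in S, adj v s,
    forall t, t \in S -> adj v t -> t = s & conn (@adj T) (v |: S)].
Proof.
move=> [cT aT] cS /set0Pn[s0 Ss0] nST.
have [v [s [nSv Ss avs]]] : exists v s, [/\ v \notin S, s \in S & adj v s].
  apply: contrapT => no; case/eqP: nST; apply/setP => x; rewrite finset.in_setT.
  have clS : fingraph.closed (@adj T) (mem S).
    apply: (intro_closed (sym_connect_sym _)); first by move=> ? ?; exact: adj_sym.
    move=> a c aac Sa; apply: contrapT => /negP nSc; apply: no.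
    by exists c, a; split=> //; rewrite adj_sym.
  by rewrite -(closed_connect clS (cT s0 x)) Ss0.
exists v, s; split=> //; last first.
  move=> R x Rx; rewrite in_setU1 => vSx clR.
  have cRS : closed_in (@adj T) S R.
    by move=> a c Ra Sa Sc; apply: clR; rewrite // in_setU1 ?Sa ?Sc orbT.
  have [vSv vSs] : v \in v |: S /\ s \in v |: S by rewrite !in_setU1 eqxx Ss orbT.
  have RS : s \in R -> S \subset R by move=> Rs; exact: (cS R s).
  have [Rs|nRs] := boolP (s \in R).
    by rewrite subUset sub1set RS // andbT (clR s) // adj_sym.
  case/orP: vSx => [/eqP xv|Sx].
    by case/negP: nRs; apply: (clR v) => //; rewrite -xv.
  by case/negP: nRs; exact: (subsetP (cS R x Rx Sx cRS)).
move=> t St avt; apply/eqP/negPn/negP => nts.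
pose eS := [rel a c : T | adj a c && (a \in S) && (c \in S)].
have : t \in [set c | connect eS s c].
  suff /subsetP/(_ t St) : S \subset [set c | connect eS s c] by [].
  apply: (cS _ s) => //; first by rewrite inE connect0.
  move=> a c; rewrite !inE => sa Sa Sc aac; apply: connect_trans sa (connect1 _).
  by rewrite /= aac Sa.
rewrite inE => /connectP[p0 p0P et]; move: nts avt.
rewrite et; case/shortenP: p0P => p pP up _ nts avt.
have pS : {subset p <= S}.
  move: pP; elim: (p) (s) => // c q IHq a /= /andP[/andP[_ Sc] /IHq qS] z.
  by rewrite inE => /predU1P[->|/qS].
have nSp : v \notin s :: p.
  by rewrite inE negb_or; apply/andP; split;
    [apply: contraNneq nSv => ->|apply: contra nSv => /pS].
apply: (aT [:: v, s & p]); first by case: p nts {pP up pS nSp avt} => //=; rewrite eqxx.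
rewrite /ucycle cons_uniq nSp up !andbT /= avs rcons_path /=.
apply/andP; split; first by apply: sub_path pP => a c /andP[/andP[]].
by rewrite adj_sym.
Qed.

(** * Growing a model of the tree *)

Section Growth.
Variables (T : sgraph) (V : finType) (e : rel V) (k : nat).
Hypothesis e_sym : symmetric e.
Implicit Types (S : {set T}) (X : {set V}).

(* [D] is a model of the subgraph of [T] induced by [S], with branch sets
   inside [X]. *)
Definition model S X (D : T -> {set V}) := [/\
  forall t, t \in S -> conn e (D t) /\ D t \subset X,
  forall s t x, s \in S -> t \in S -> x \in D s -> x \in D t -> s = t &
  forall s t, s \in S -> t \in S -> adj s t ->
    exists x y, [/\ x \in D s, y \in D t & e x y]].

(* The invariant of Diestel's proof of the pathwidth theorem. *)
Definition grown S := exists X D (b : T -> V), [/\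
  extendable e k X /\ #|bdry e X| <= #|S|, model S X D,
  forall t, t \in S -> b t \in D t /\ b t \in bdry e X &
  forall Y, extendable e k Y -> #|bdry e Y| <= #|S| -> X \subset Y -> Y = X].

(** [X] grows by [y] and then to a maximal extendable [Y], whose boundary may have one more vertex.
    Links from [y |: X] to [Y] prolong the branch sets to the new boundary, where they can be met by
    later ones. *)
Lemma grow S X D b v y : #|S| < k -> v \notin S -> y \notin X ->
  extendable e k X /\ #|bdry e X| <= #|S| -> model S X D ->
  (forall t, t \in S -> b t \in D t /\ b t \in bdry e X) ->
  (forall Y, extendable e k Y -> #|bdry e Y| <= #|S| -> X \subset Y -> Y = X) ->
  (forall t, t \in S -> adj v t -> exists2 x, x \in D t & e x y) ->
  grown (v |: S).
Proof.
move=> ltSk nSv nXy [exX leX] [D1 D2 D3] bP maxX Dv.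
pose X1 := y |: X; have X1y : y \in X1 by rewrite in_setU1 eqxx.
have sXX1 : X \subset X1 := subsetUr _ _.
have cvS : #|v |: S| = #|S|.+1 by rewrite cardsU1 nSv.
have exX1 : extendable e k X1 by apply: extendableU1 => //; exact: leq_ltn_trans leX ltSk.
(* A smaller boundary would contradict the maximality of [X], which does not contain [y]. *)
have minX1 Z : extendable e k Z -> X1 \subset Z -> #|v |: S| <= #|bdry e Z|.
  move=> exZ sXZ; rewrite cvS ltnNge; apply: contra nXy => leZ.
  by rewrite -(maxX Z) ?(subset_trans sXX1) // (subsetP sXZ).
have sBX1 : bdry e X1 \subset y |: bdry e X.
  apply/subsetP => x /bdryP[]; rewrite !in_setU1 => /predU1P[->|Xx [z exz]].
    by rewrite eqxx.
  rewrite in_setU1 negb_or => /andP[_ nXz]; apply/orP; right.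
  by apply/bdryP; split=> //; exists z.
(* By counting: the boundary of [X1] has at least [#|S| + 1] vertices, so none of [bdry e X] is lost
   and every [b t] still lies on it. *)
have BX1 : bdry e X1 = y |: bdry e X.
  apply/eqP; rewrite eqEcard sBX1 (leq_trans _ (minX1 _ exX1 (subxx _))) //.
  rewrite cvS cardsU1 -add1n; apply: leq_trans (_ : 1 + #|bdry e X| <= _).
    by rewrite leq_add2r; case: (_ \notin _).
  by rewrite leq_add2l.
have leX1 : #|bdry e X1| <= #|v |: S|.
  by rewrite BX1 cvS cardsU1 -add1n leq_add // ; case: (_ \notin _).
have [Y [exY leY sX1Y maxY]] := extendable_max exX1 leX1.
have [Q [Q1 Q2 Q3]] : exists Q : V -> {set V}, linked e X1 Y Q.
  apply: linkage => // Z sX1Z sZY.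
  pose p (W : {set V}) := (X1 \subset W) && (W \subset Y).
  have pY : p Y by rewrite /p sX1Y subxx.
  (* An arbitrary [Z] between [X1] and [Y] need not be extendable. One of minimum boundary is, being
     linked to [Y], so [minX1] bounds its boundary from below, and with it that of every other
     [Z]. *)
  case: (arg_minnP (fun W => #|bdry e W|) pY) => W /andP[sX1W sWY] minW.
  have [W' sWW' sW'Y|Q LQ] := linkage e_sym sWY.
    by apply: minW; rewrite /p sW'Y (subset_trans sX1W).
  have exW := extendable_linked e_sym sWY LQ exY.
  rewrite (leq_trans leX1) // (leq_trans (minX1 _ exW sX1W)) //.
  by apply: minW; rewrite /p sX1Z.
pose D0 t := if t == v then [set y] else D t.
pose c t := if t == v then y else b t.
have vSP t : t \in v |: S -> t = v \/ t \in S /\ (t == v) = false.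
  rewrite in_setU1; case: eqVneq => [->|_] /= h; [by left|by right].
have cP t : t \in v |: S -> [/\ c t \in D0 t, c t \in bdry e X1 & D0 t \subset X1].
  rewrite /c /D0 BX1 => /vSP[->|[St ->]]; first by rewrite eqxx set11 in_setU1 eqxx sub1set.
  have [bD bX] := bP t St; rewrite bD in_setU1 bX orbT; split=> //.
  by apply: subset_trans sXX1; case: (D1 t St).
have D0d s t x : s \in v |: S -> t \in v |: S -> x \in D0 s -> x \in D0 t -> s = t.
  have nDy u : u \in S -> y \notin D u.
    by move=> Su; apply: contra nXy; exact: (subsetP (D1 u Su).2).
  rewrite /D0 => /vSP[->|[Ss ->]] /vSP[->|[St ->]]; rewrite ?eqxx //.
  - by move=> /set1P-> Dy; case/negP: (nDy t St).
  - by move=> Dx /set1P ex; case/negP: (nDy s Ss); rewrite -ex.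
  - exact: D2.
have wP t : exists w, t \in v |: S -> w \in Q (c t) /\ w \in bdry e Y.
  have [vSt|] := boolP (t \in v |: S); last by exists y.
  by have [_ cB _] := cP t vSt; have [_ _ _ [w]] := Q1 _ cB; exists w.
have [b' b'P] := choice wP.
exists Y, (fun t => D0 t :|: Q (c t)), b'; split=> //.
- split=> [t vSt|s t x vSs vSt|s t vSs vSt ast].
  + have [cD cB sD] := cP t vSt; have [Qc cQ sQ _] := Q1 _ cB.
    split; last by rewrite subUset sQ (subset_trans sD).
    apply: (connU e_sym cD Qc) => //; rewrite /D0.
    by case/vSP: vSt => [->|[St ->]]; [rewrite eqxx; exact: conn1|case: (D1 t St)].
  + have [cDs cBs sDs] := cP s vSs; have [cDt cBt sDt] := cP t vSt.
    rewrite !in_setU => /orP[Ds|Qs] /orP[Dt|Qt].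
    * exact: D0d Dt.
    * by apply: (D0d _ _ x) => //; rewrite (Q2 _ _ cBt Qt) // (subsetP sDs).
    * by apply: (D0d _ _ x) => //; rewrite (Q2 _ _ cBs Qs) // (subsetP sDt).
    * by apply: (D0d _ _ (c s)) => //; rewrite (Q3 _ _ _ cBs cBt Qs Qt).
  + suff [x [z [D0x D0z exz]]] : exists x z, [/\ x \in D0 s, z \in D0 t & e x z].
      by exists x, z; rewrite !in_setU D0x D0z.
    move: vSs vSt; rewrite /D0 => /vSP[es|[Ss ->]] /vSP[et|[St ->]].
    * by move: ast; rewrite es et adj_irr.
    * have [|x Dx exy] := Dv t St; first by rewrite -es.
      by exists y, x; rewrite es eqxx set11 Dx e_sym.
    * have [|x Dx exy] := Dv s Ss; first by rewrite -et adj_sym.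
      by exists x, y; rewrite et eqxx set11 Dx.
    * exact: D3.
- move=> t vSt; have [Qb Bb] := b'P t vSt; by rewrite in_setU Qb orbT.
Qed.

Lemma grown_all : trees T -> #|T| <= k -> ~ extendable e k [set: V] -> grown [set: T].
Proof.
move=> treeT leTk nexT.
have outX X : extendable e k X -> exists y, y \notin X.
  move=> exX; apply: contrapT => no; apply: nexT; suff -> : [set: V] = X by [].
  by apply/setP => y; rewrite finset.in_setT; apply/esym/negPn/negP => nXy; apply: no; exists y.
suff grownS n : n <= #|T| -> exists2 S : {set T}, #|S| = n & conn (@adj T) S /\ grown S.
  have [S cS [_ gS]] := grownS _ (leqnn _); suff <- : S = [set: T] by [].
  by apply/eqP; rewrite eqEcard finset.subsetT cardsT cS /=.
elim: n => [_|n IHn ltnT].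
  exists finset.set0; first exact: cards0.
  split; first by move=> R x _; rewrite inE.
  have [|X [exX leX _ maxX]] := @extendable_max V e k 0 _ (extendable0 e k).
    rewrite leqn0 cards_eq0 -subset0; apply/subsetP => x.
    by case/bdryP; rewrite inE.
  have [y _] := outX X exX.
  exists X, (fun=> finset.set0), (fun=> y); rewrite cards0; split=> [//||t|//]; rewrite ?inE //.
  by split=> [t|s t x|s t]; rewrite inE.
have [|S cS [connS [X [D [b [[exX leX] mX bP maxX]]]]]] := IHn; first exact: ltnW.
have ltSk : #|S| < k by rewrite cS (leq_trans ltnT).
have nST : S != [set: T] by apply: contraTneq ltnT => eS; rewrite -cS eS cardsT ltnn.
have [S0|S0] := eqVneq S finset.set0.
  have [y nXy] := outX X exX.
  have /card_gt0P[v _] : 0 < #|T| by exact: leq_ltn_trans ltnT.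
  have nSv : v \notin S by rewrite S0 inE.
  exists (v |: S); first by rewrite cardsU1 nSv cS.
  split; first by rewrite S0 setU0; exact: conn1.
  by apply: (grow ltSk nSv nXy _ mX bP) => // t; rewrite S0 inE.
have [v [s [nSv Ss avs uniqs connvS]]] := tree_next_vertex treeT connS S0 nST.
(* The representative [b s] has a neighbour [y] outside [X]; taking it as the branch set of [v]
   realizes the tree edge [vs]. *)
have [Ds /bdryP[_ [y ey nXy]]] := bP s Ss.
exists (v |: S); first by rewrite cardsU1 nSv cS.
split=> //; apply: (grow ltSk nSv nXy _ mX bP) => // t St /(uniqs t St) ->.
by exists (b s).
Qed.

End Growth.

(** * From models to minors *)

Lemma spanning_subgraph_minor (T G : sgraph) (f : T -> G) : bijective f ->
  (forall s t, adj s t -> adj (f s) (f t)) -> minor T G.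
Proof.
have [n] := ubnP #|[pred p : G * G | adj p.1 p.2]|.
elim: n G f => // n IHn G f ltGn bf homf.
have [isof|] := pselect (forall s t, adj (f s) (f t) -> adj s t).
  apply/minor_iso; exists f => // s t; apply/idP/idP; [exact: isof|exact: homf].
move=> /existsNP[s /existsNP[t /not_implyP[afst nast]]].
apply: (minor_del_edge afst); apply: (IHn _ (f : T -> del_edge (f s) (f t))) => //.
  rewrite -ltnS; apply: leq_trans ltGn; rewrite ltnS; apply: proper_card.
  apply/properP; split; first by apply/subsetP => p; rewrite !inE => /andP[].
  by exists (f s, f t); rewrite !inE //= /adj/= /del_edge_adj afst eqxx.
move=> a c aac; rewrite /adj/= /del_edge_adj homf //=; apply: contra_notN nast => /eqP eset.
have injf := bij_inj bf.
have : f a \in [set f s; f t] by rewrite -eset set21.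
have : f c \in [set f s; f t] by rewrite -eset set22.
rewrite !in_set2 !(inj_eq injf) => /orP[/eqP ec|/eqP ec] /orP[/eqP ea|/eqP ea].
- by rewrite ea ec adj_irr in aac.
- by rewrite adj_sym -ea -ec.
- by rewrite -ea -ec.
- by rewrite ea ec adj_irr in aac.
Qed.

Lemma conn_edge (G : sgraph) (Q : {set G}) x y : conn (@adj G) Q ->
  x \in Q -> y \in Q -> x != y -> exists2 z, z \in Q & adj x z.
Proof.
move=> cQ Qx Qy; apply: contra_neqP => no.
suff /subsetP/(_ y Qy) : Q \subset [set x] by move=> /set1P.
apply: (cQ _ x); rewrite ?set11 // => u v /set1P-> _ Qv axv.
by case: no; exists v.
Qed.

(** Induction on the number of vertices: delete a vertex outside all branch sets, or else contract
    an edge inside a branch set with at least two vertices. What finally remains is a spanning copy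
    of [T], possibly with extra edges. *)
Lemma model_minor (T G : sgraph) (D : T -> {set G}) :
  model (@adj G) [set: T] [set: G] D -> (forall t, D t != finset.set0) -> minor T G.
Proof.
have [n] := ubnP #|G|; elim: n G D => // n IHn G D ltGn [D1 D2 D3] D0.
have {}D1 t : conn (@adj G) (D t) by case: (D1 t (finset.in_setT t)).
have {}D2 s t x : x \in D s -> x \in D t -> s = t by apply: D2; rewrite finset.in_setT.
have {}D3 s t : adj s t -> exists x y, [/\ x \in D s, y \in D t & adj x y].
  by apply: D3; rewrite finset.in_setT.
have ltsub (v : G) : #|{: {x : G | x != v}}| < n.
  rewrite -ltnS; apply: leq_trans ltGn; rewrite ltnS card_sub.
  by apply: proper_card; apply/properP; split; [exact: subset_predT|exists v; rewrite ?inE ?eqxx].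
have [[v nDv]|cover] := pselect (exists v, forall t, v \notin D t).
  pose D' t : {set del_vertex v} := [set x | val x \in D t].
  have vD' t x (Dx : x \in D t) : exists2 x' : del_vertex v, val x' = x & x' \in D' t.
    have xv : x != v by apply: contraNneq (nDv t) => <-.
    by exists (Sub x xv); rewrite ?inE SubK.
  apply: (@minor_del_vertex _ _ v); apply: (IHn _ D') => [|//|t].
    - exact: ltsub.
    - split=> [t _|s t x _ _|s t _ _ /D3[x [y [Dx Dy axy]]]].
      + split; last exact: finset.subsetT.
        move=> S x Sx D'x clS; have D'S : D t \subset [set val y | y in S].
          apply: (D1 t _ (val x)); [exact: imset_f|by rewrite inE in D'x|].
          move=> _ w /imsetP[u Su ->] Du Dw auw; have [w' ew D'w] := vD' t w Dw.
          rewrite -ew; apply/imset_f/(clS u) => //; first by rewrite inE.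
          by rewrite /adj/= /del_vertex_adj ew.
        apply/subsetP => y; rewrite inE => /(subsetP D'S)/imsetP[z Sz /val_inj->] //.
      + by rewrite !inE; exact: D2.
      + have [x' ex Dx'] := vD' s x Dx; have [y' ey Dy'] := vD' t y Dy.
        by exists x', y'; split=> //; rewrite /adj/= /del_vertex_adj ex ey.
    - by have /set0Pn[x Dx] := D0 t; have [x' _ Dx'] := vD' t x Dx; apply/set0Pn; exists x'.
have [[t [x [y [Dx Dy nxy]]]]|sing] :=
    pselect (exists t x y, [/\ x \in D t, y \in D t & x != y]).
  have [v Dv axv] := conn_edge (D1 t) Dx Dy nxy; have xv : x != v.
    by apply: contraTneq axv => ->; rewrite adj_irr.
  pose D' s : {set Defs.contract x v} := [set z | val z \in D s].
  have mD s z : z \in D s -> Defs.merge x v z \in D s.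
    by rewrite /Defs.merge; case: eqP => // -> /(D2 s t v)/(_ Dv) ->.
  have mv z : Defs.merge x v z != v by rewrite /Defs.merge; case: ifPn.
  have vD' s z (Dz : z \in D s) :
      exists2 z' : Defs.contract x v, val z' = Defs.merge x v z & z' \in D' s.
    by exists (Sub (Defs.merge x v z) (mv z)); rewrite ?inE SubK ?mD.
  have mval (z : Defs.contract x v) : Defs.merge x v (val z) = val z.
    by rewrite /Defs.merge (negbTE (valP z)).
  apply: (minor_contract axv); apply: (IHn _ D') => [|//|s].
    - exact: ltsub.
    - split=> [s _|s r z _ _|s r _ _ asr].
      + split; last exact: finset.subsetT.
        move=> S z Sz D'z clS.
        have D'S : D s \subset [set w | Defs.merge x v w \in [set val y | y in S]].
          apply: (D1 s _ (val z)); [|by rewrite inE in D'z|].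
            by rewrite inE mval imset_f.
          move=> a w; rewrite !inE => /imsetP[a' Sa' ea] Da Dw aaw.
          have [w' ew D'w] := vD' s w Dw; rewrite -ew; apply: imset_f.
          have [<-//|naw] := eqVneq a' w'.
          apply: (clS a') => //; first by rewrite inE -ea mD.
          rewrite /adj/= /contract_adj naw /=; apply/existsP; exists a; apply/existsP; exists w.
          by rewrite ea ew !eqxx.
        apply/subsetP => w; rewrite inE => /(subsetP D'S).
        by rewrite inE mval => /imsetP[u Su /val_inj->].
      + by rewrite !inE; exact: D2.
      + have [a [c [Da Dc aac]]] := D3 s r asr.
        have [a' ea Da'] := vD' s a Da; have [c' ec Dc'] := vD' r c Dc.
        exists a', c'; split=> //; rewrite /adj/= /contract_adj; apply/andP; split.
          apply: contraTneq asr => eac; rewrite (_ : s = r) ?adj_irr //.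
          by move: Da' Dc'; rewrite !inE eac => Da' /(D2 _ _ _ Da').
        by apply/existsP; exists a; apply/existsP; exists c; rewrite ea ec !eqxx.
    - by have /set0Pn[z Dz] := D0 s; have [z' _ Dz'] := vD' s z Dz; apply/set0Pn; exists z'.
have [f fD] := choice (fun t => set0Pn _ (D0 t)).
have fD1 t x : x \in D t -> x = f t.
  by move=> Dx; apply/eqP/negPn/negP => nx; apply: sing; exists t, x, (f t).
have gP (x : G) : exists t, x \in D t.
  apply: contrapT => no; apply: cover; exists x => t.
  by apply/negP => Dx; apply: no; exists t.
have [g gD] := choice gP.
apply: (@spanning_subgraph_minor _ _ f).
  by exists g => [t|x]; [exact: (D2 _ _ (f t))|rewrite -(fD1 (g x) x)].
by move=> s t /D3[x [y [/fD1-> /fD1->]]].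
Qed.

Theorem excluding_tree_interval_rep (T G : sgraph) : trees T -> excluding T G ->
  exists l r, interval_rep (@adj G) #|T| [set: G] l r.
Proof.
move=> treeT exTG; apply: contrapT => no.
have [|X [D [b [_ mD bP _]]]] := @grown_all T G _ #|T| (@adj_sym G) treeT (leqnn _).
  by case=> l [r [N [rep _ _]]]; apply: no; exists l, r.
apply: exTG; apply: (@model_minor _ _ D) => [|t].
  case: mD => D1 D2 D3; split=> // t /D1[cD _]; split=> //; exact: finset.subsetT.
by apply/set0Pn; exists (b t); case: (bP t); rewrite ?finset.in_setT.
Qed.

(** * Forests and shortest paths *)

Local Open Scope ring_scope.

Section Forests.
Variable V : finType.
Implicit Types (B S U : {set V}) (p : V -> V) (rk : V -> nat).

(* Rooted forests are given by a parent function, whose fixed points are the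
   roots. *)
Definition forest B p rk :=
  forall x, x \in B -> p x \in B /\ (p x = x \/ (rk (p x) < rk x)%N).

Lemma forest_ind B p rk (P : V -> Prop) : forest B p rk ->
  (forall x, x \in B -> (p x != x -> P (p x)) -> P x) -> forall x, x \in B -> P x.
Proof.
move=> fB IH x; have [n] := ubnP (rk x); elim: n x => // n IHn x ltn Bx.
apply: IH => // nx; have [Bpx [/eqP|lt]] := fB x Bx; first by rewrite (negbTE nx).
by apply: IHn => //; rewrite -ltnS (leq_trans _ ltn).
Qed.

Lemma forest_rec B p rk (A : Type) (base : V -> A) (step : V -> A -> A) :
  forest B p rk -> exists h : V -> A, forall x, x \in B ->
    h x = if p x == x then base x else step x (h (p x)).
Proof.
move=> fB.
pose fix h n x {struct n} := if n is n'.+1 then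
  if p x == x then base x else step x (h n' (p x)) else base x.
have hE n m x : x \in B -> (rk x < n)%N -> (rk x < m)%N -> h n x = h m x.
  elim: n m x => // n IHn [//|m] x Bx ltn ltm /=; case: eqP => // nx.
  have [Bpx [//|lt]] := fB x Bx; congr step.
  by apply: IHn; rewrite // -ltnS (leq_trans _ ltn, leq_trans _ ltm).
exists (fun x => h (rk x).+1 x) => x Bx /=; case: eqP => // nx; congr step.
by have [Bpx [//|lt]] := fB x Bx; exact: (hE _ (rk (p x)).+1).
Qed.

Lemma forest_anc B p rk x z : forest B p rk -> x \in B -> fconnect p x z -> z \in B.
Proof.
by move=> fB Bx /iter_findex <-; elim: (findex _ _ _) => //= n /fB[].
Qed.

Lemma forest_anc_rel B p rk (r : rel V) x z : forest B p rk ->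
  reflexive r -> transitive r -> (forall y, y \in B -> r y (p y)) ->
  x \in B -> fconnect p x z -> r x z.
Proof.
move=> fB rr rt rp Bx /iter_findex <-; move: (findex p x z) => n.
elim: n x Bx => [|n IHn] x Bx; first exact: rr.
by rewrite iterSr; apply: rt (rp x Bx) (IHn _ _); case: (fB x Bx).
Qed.

End Forests.

(** * Dijkstra's algorithm and geodesics *)

Section ShortestPaths.
Variables (R : realType) (V : finType) (e : rel V) (w : V -> V -> R).
Hypotheses (e_sym : symmetric e) (w_sym : forall x y, w x y = w y x).
Hypothesis w_ge0 : forall x y, e x y -> 0 <= w x y.
Implicit Types (A B C S U : {set V}) (f g : V -> R).

(* A real tree or edge length dominates the shortest-path metric of the
   subgraph induced by [B] iff it dominates the variation of all [f] that are
   1-Lipschitz on [B]; this replaces the metric itself in what follows. *)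
Definition lip B f := forall x y, x \in B -> y \in B -> e x y -> f x - f y <= w x y.

Lemma lip_sub B C f : C \subset B -> lip B f -> lip C f.
Proof. by move=> /subsetP sCB lf x y /sCB Bx /sCB By; exact: lf. Qed.

Lemma lip_norm B f x y : lip B f -> x \in B -> y \in B -> e x y -> `|f x - f y| <= w x y.
Proof.
move=> lf Bx By exy; have := lf x y Bx By exy.
by have := lf y x By Bx; rewrite e_sym exy w_sym ler_norml => /(_ isT) ? ?; lra.
Qed.

(** A state of Dijkstra's algorithm from the sources [U], with explored set [S]. That [D] is the
    distance to [U] within [S] is split in two: [lip] bounds it by the length of every path, and the
    parents attain it. Edges may have length 0, so [rk] and not [D] shows that parents lead to
    [U]. *)
Definition dijkstra B U S p rk (D : V -> R) := [/\
  (U \subset S) && (S \subset B), lip S D,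
  forall x, x \in U -> p x = x /\ D x = 0 &
  forall x, x \in S -> x \notin U ->
    [/\ p x \in S, e x (p x), (rk (p x) < rk x)%N & D x = D (p x) + w x (p x)]].

Lemma dijkstra_exists B U : U \subset B ->
  exists S p rk D, dijkstra B U S p rk D /\ closed_in e B S.
Proof.
move=> sUB.
(* The second clause says that vertices are explored in order of distance. It keeps [D] 1-Lipschitz
   between an old vertex and the new one. *)
pose inv S p rk D := dijkstra B U S p rk D /\
  forall s s' x, s \in S -> s' \in S -> x \in B -> x \notin S -> e s' x ->
    D s <= D s' + w s' x.
suff grow n S p rk D : (#|B :\: S| < n)%N -> inv S p rk D ->
    exists S p rk D, dijkstra B U S p rk D /\ closed_in e B S.
  apply: (grow _ U id (fun=> 0%N) (fun=> 0) (ltnSn _)); split.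
    split=> // [|x y Ux Uy|x -> //]; first by rewrite subxx.
    by rewrite subr0; exact: w_ge0.
  by move=> s s' x _ _ _ _ /w_ge0; rewrite add0r.
elim: n S p rk D => // n IHn S p rk D ltn [[sS lD DU DS] minD].
have /andP[sUS /subsetP sSB] := sS.
pose out (q : V * V) := [&& q.1 \in S, q.2 \in B, q.2 \notin S & e q.1 q.2].
have [q0 out0|noout] := pickP out; last first.
  exists S, p, rk, D; split=> // u v Su _ Bv euv; apply/negPn/negP => nSv.
  by have := noout (u, v); rewrite /out /= Su Bv nSv euv.
case: (arg_minP (fun q : V * V => D q.1 + w q.1 q.2) out0) => -[s x].
rewrite /out /= => /and4P[Ss Bx nSx esx] minq.
have {}minq s' x' : s' \in S -> x' \in B -> x' \notin S -> e s' x' ->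
    D s + w s x <= D s' + w s' x'.
  by move=> Ss' Bx' nSx' es'x'; apply: (minq (s', x')); rewrite /= Ss' Bx' nSx' es'x'.
have SxF y : y \in S -> (y == x) = false by move=> Sy; apply: contraNF nSx => /eqP<-.
pose D' y := if y == x then D s + w s x else D y.
pose p' y := if y == x then s else p y.
pose rk' y := if y == x then (rk s).+1 else rk y.
have D'le y : y \in x |: S -> D' y <= D s + w s x.
  rewrite in_setU1 /D'; case: eqP => //= _ Sy; exact: minD.
apply: (IHn (x |: S) p' rk' D').
  rewrite -ltnS; apply: leq_trans ltn; rewrite ltnS; apply: proper_card.
  apply/properP; split; first by apply: setDS; exact: subsetUr.
  by exists x; rewrite !inE ?nSx ?Bx // eqxx.
split; first split.
- rewrite (subset_trans sUS (subsetUr _ _)) /=; apply/subsetP => y.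
  by rewrite in_setU1 => /predU1P[->//|/sSB].
- move=> y z Sy Sz eyz; have := D'le y Sy; move: Sy Sz; rewrite !in_setU1 /D'.
  have [ey|_] /= := eqVneq y x; have [ez|_] /= := eqVneq z x => Sy Sz.
  + by move=> _; rewrite subrr; exact: w_ge0.
  + by move=> _; rewrite lerBlDl ey in eyz *; rewrite (w_sym x) minq // e_sym.
  + by move=> le1; rewrite lerBlDl; apply: le_trans le1 _; rewrite -ez lerDl w_ge0.
  + by move=> _; exact: lD.
- move=> y Uy; have Sy := subsetP sUS _ Uy; by rewrite /p' /D' SxF //; exact: DU.
- move=> y; rewrite !in_setU1 /p' /D' /rk'; have [->|_] /= := eqVneq y x.
    by move=> _ _; rewrite Ss orbT SxF // e_sym w_sym; split.
  move=> Sy nUy; have [Sp ep rp Dp] := DS y Sy nUy.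
  by rewrite !SxF // Sp orbT.
- move=> u v y Su; rewrite !in_setU1 negb_or => Sv By /andP[nyx nSy] evy.
  apply: le_trans (D'le u Su) _.
  move: Sv evy; rewrite /D'; have [->|_] /= := eqVneq v x => [_ exy|Sv evy].
    by rewrite lerDl w_ge0.
  exact: minq.
Qed.

End ShortestPaths.

Section Geodesics.
Variables (R : realType) (V : finType) (e : rel V) (w : V -> V -> R).
Hypotheses (e_sym : symmetric e) (w_sym : forall x y, w x y = w y x).
Hypothesis w_ge0 : forall x y, e x y -> 0 <= w x y.
Implicit Types (A B C S U : {set V}) (f g : V -> R).
Notation lip := (lip e w).

Lemma dijkstra_forest B U S p rk D : dijkstra e w B U S p rk D -> forest S p rk.
Proof.
move=> [/andP[/subsetP sUS _] _ DU DS] x Sx; have [Ux|nUx] := boolP (x \in U).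
  by have [-> _] := DU x Ux; split; [exact: sUS|left].
by have [? _ ? _] := DS x Sx nUx; split=> //; right.
Qed.

Lemma dijkstra_conn B U S p rk D : conn e B -> U != finset.set0 ->
  dijkstra e w B U S p rk D -> closed_in e B S -> S = B.
Proof.
move=> cB /set0Pn[u Uu] [/andP[/subsetP sUS sSB] _ _ _] clS.
apply/eqP; rewrite finset.eqEsubset sSB (cB S u) ?sUS //.
by apply: (subsetP sSB); exact: sUS.
Qed.

(** [a x] is the root above [x] in the shortest-path forest from [A]. The bound for all [g]
    expresses that [x] is within [d x] of [a x]. *)
Lemma nearest_point B A : conn e B -> A \subset B -> A != finset.set0 ->
  exists d a, [/\ lip B d, forall x, x \in A -> d x = 0 &
    forall x, x \in B -> [/\ a x \in A, 0 <= d x &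
      forall g, lip B g -> `|g x - g (a x)| <= d x]].
Proof.
move=> cB sAB A0; have [S [p [rk [D [dij clS]]]]] := dijkstra_exists e_sym w_sym w_ge0 sAB.
have eSB := dijkstra_conn cB A0 dij clS; rewrite eSB in dij; have fB := dijkstra_forest dij.
have [a aE] := forest_rec id (fun _ a => a) fB; have [_ lD DA DB] := dij.
exists D, a; split=> // [x /DA[]//|]; apply: (forest_ind fB) => x Bx IH.
have [Ax|nAx] := boolP (x \in A).
  have [px Dx] := DA x Ax; rewrite aE // px eqxx Dx; split=> // g _.
  by rewrite subrr normr0.
have [Bp ep lt Dp] := DB x Bx nAx.
have npx : p x != x by apply: contraTneq lt => ->; rewrite ltnn.
have [Aa Dp0 Lp] := IH npx; rewrite aE // (negbTE npx) Dp; split=> [//||g lg].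
  by rewrite addr_ge0 ?w_ge0.
rewrite -(subrKA (g (p x))) (le_trans (ler_normD _ _)) // addrC lerD ?Lp //.
exact: (lip_norm e_sym w_sym lg).
Qed.

(* [A] is the vertex set of a path rooted at one end, along which [f] measures
   the distance to the root. *)
Definition geodesic B A p rk f := [/\
  A \subset B, forest A p rk, lip B f,
  forall x g, x \in A -> lip B g -> `|g x - g (p x)| <= f x - f (p x) &
  forall x y, x \in A -> y \in A -> fconnect p x y \/ fconnect p y x].

Lemma geodesic_exists k B l r : conn e B -> B != finset.set0 ->
  interval_rep e k.+1 B l r -> exists A p rk f,
    [/\ A != finset.set0, geodesic B A p rk f & interval_rep e k (B :\: A) l r].
Proof.
move=> cB /set0Pn[x0 Bx0] [lr ov bags].
have [u Bu minu] : exists2 u, u \in B & forall x, x \in B -> (l u <= l x)%N.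
  by case: (arg_minnP l Bx0) => u; exists u.
have [v Bv maxv] : exists2 v, v \in B & forall x, x \in B -> (r x <= r v)%N.
  by case: (arg_maxnP r Bx0) => v; exists v.
have U0 : [set u] != finset.set0 by apply/set0Pn; exists u; exact: set11.
have sUB : [set u] \subset B by rewrite sub1set.
have [S [p [rk [D [dij clS]]]]] := dijkstra_exists e_sym w_sym w_ge0 sUB.
have eSB := dijkstra_conn cB U0 dij clS; rewrite eSB in dij; have fB := dijkstra_forest dij.
have [_ lD DU DB] := dij; have [pu Du] := DU u (set11 u).
have stepB x : x \in B -> p x = x \/ [/\ e x (p x) & D x = D (p x) + w x (p x)].
  have [/set1P->|nU Bx] := boolP (x \in [set u]); first by left.
  by have [_ ? _ ?] := DB x Bx nU; right.
(* The ancestors of [v] in the shortest-path tree from [u] are the vertices of a shortest path. *)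
pose A := [set q | fconnect p v q].
have Av : v \in A by rewrite inE connect0.
have sAB : A \subset B by apply/subsetP => q; rewrite inE => /(forest_anc fB Bv).
have Ap q : q \in A -> p q \in A.
  by rewrite !inE => vq; apply: connect_trans vq (fconnect1 _ _).
have Au : u \in A.
  rewrite inE; move: v Bv {maxv A Av sAB Ap}; apply: (forest_ind fB) => x Bx IH.
  have [/set1P->|nU] := boolP (x \in [set u]); first exact: connect0.
  have [_ _ lt _] := DB x Bx nU.
  apply: connect_trans (fconnect1 p x) (IH _).
  by apply: contraTneq lt => ->; rewrite ltnn.
have cA : conn e A.
  apply: (conn_root e_sym Av) => T Tv clT; apply/subsetP => q; rewrite inE => /iter_findex <-.
  elim: (findex _ _ _) => //= n IHn.
  have An : iter n p v \in A by rewrite inE fconnect_iter.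
  have [->//|[en _]] := stepB _ (subsetP sAB _ An).
  by apply: clT en => //; exact: Ap.
exists A, p, rk, D; split; first by apply/set0Pn; exists u.
- split=> // [x Ax|x g Ax lg|x y].
  + by have [_ ?] := fB x (subsetP sAB _ Ax); split=> //; exact: Ap.
  + have Bx := subsetP sAB _ Ax; have [->|[ex Dx]] := stepB x Bx.
      by rewrite !subrr normr0.
    rewrite Dx addrAC subrr add0r; apply: (lip_norm e_sym w_sym lg) => //.
    by case: (fB x Bx).
  + rewrite !inE => /iter_findex <- /iter_findex <-.
    move: (findex p v x) (findex p v y) => i j.
    wlog le : i j / (i <= j)%N.
      by move=> H; case: (leqP i j) => [|/ltnW] /H // []; [right|left].
    by left; rewrite -(subnK le) iterD fconnect_iter.
- split=> [x|x y|t]; rewrite ?in_setD.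
  + by move=> /andP[_ /lr].
  + by move=> /andP[_ Bx] /andP[_ By]; exact: ov.
  have sbag : bag (B :\: A) l r t \subset bag B l r t.
    by apply/subsetP => x; rewrite !inE => /andP[/andP[_ ->]].
  have [e0|/set0Pn[x]] := eqVneq (bag B l r t) finset.set0.
    by rewrite (leq_trans (subset_leq_card sbag)) // e0 cards0.
  rewrite inE => /and3P[Bx lx rx].
  have [q Aq tq] : exists2 q, q \in A & (l q <= t <= r q)%N.
    apply: (conn_cross e_sym cA _ Au Av).
      by move=> y z Ay Az; apply: ov; exact: (subsetP sAB).
    by rewrite (leq_trans (minu x Bx) lx) (leq_trans rx (maxv x Bx)).
  rewrite -ltnS (leq_trans _ (bags t)) // proper_card //; apply/properP; split=> //.
  by exists q; rewrite [_ \in _]finset.in_set ?in_setD ?tq ?(subsetP sAB q Aq) // Aq.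
Qed.

(* The random forest is uniformly distributed over [O]; [h o] is the height in
   the [o]-th forest, and [b o x y] bounds the distance from [x] to [y] in it,
   via a common ancestor [z]. *)
Definition tree_approx (D : R) B := exists (O : finType) (p : O -> V -> V)
    (rk : O -> V -> nat) (h : O -> V -> R) (b : O -> V -> V -> R), [/\
  (0 < #|O|)%N,
  forall o, forest B (p o) (rk o),
  forall o g x, lip B g -> x \in B -> `|g x - g (p o x)| <= h o x - h o (p o x),
  forall o x y, x \in B -> y \in B -> e x y -> exists z,
    [/\ fconnect (p o) x z, fconnect (p o) y z & h o x + h o y - h o z *+ 2 <= b o x y] &
  forall x y, x \in B -> y \in B -> e x y ->
    \sum_o b o x y <= D * w x y * #|O|%:R].

Lemma tree_approx0 D : tree_approx D finset.set0.
Proof.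
exists unit, (fun=> id), (fun _ _ => 0%N), (fun _ _ => 0), (fun _ _ _ => 0).
by rewrite card_unit; split=> // [i x|i g x _|i x y|x y]; rewrite inE.
Qed.

Lemma fconnect_eq_in B p p' rk x z : forest B p rk -> {in B, p =1 p'} ->
  x \in B -> fconnect p x z -> fconnect p' x z.
Proof.
move=> fB epp' Bx /iter_findex <-; move: (findex p x z) => n; elim: n x Bx => [|n IHn] x Bx.
  exact: connect0.
rewrite iterSr epp' //; apply: connect_trans (fconnect1 p' x) _; rewrite -epp' //.
by apply: IHn; case: (fB x Bx).
Qed.

(** [S] is a union of components of [B], so the two forests can be drawn independently, on the
    product of the two index sets. *)
Lemma tree_approxU D B S : S \subset B -> closed_in e B S ->
  tree_approx D S -> tree_approx D (B :\: S) -> tree_approx D B.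
Proof.
move=> sSB clS [I1 [p1 [rk1 [h1 [b1 [I1_gt0 F1 L1 A1 E1]]]]]].
move=> [I2 [p2 [rk2 [h2 [b2 [I2_gt0 F2 L2 A2 E2]]]]]].
pose p (i : I1 * I2) x := if x \in S then p1 i.1 x else p2 i.2 x.
pose rk (i : I1 * I2) x := if x \in S then rk1 i.1 x else rk2 i.2 x.
pose h (i : I1 * I2) x := if x \in S then h1 i.1 x else h2 i.2 x.
pose b (i : I1 * I2) x y := if x \in S then b1 i.1 x y else b2 i.2 x y.
have BS x : x \in B -> x \notin S -> x \in B :\: S by move=> Bx nSx; rewrite in_setD nSx.
have BSN x : x \in B :\: S -> (x \in S) = false by rewrite in_setD => /andP[/negbTE].
have F1S i x : x \in S -> p1 i x \in S by case/(F1 i).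
have F2S i x : x \in B :\: S -> p2 i x \in B :\: S by case/(F2 i).
have eS x y : x \in B -> y \in B -> e x y -> (x \in S) = (y \in S).
  move=> Bx By exy; apply/idP/idP => Sz; first exact: clS exy.
  by apply: clS Sz By Bx _; rewrite e_sym.
have sDB : B :\: S \subset B := subsetDl _ _.
exists (I1 * I2)%type, p, rk, h, b; split.
- by rewrite card_prod muln_gt0 I1_gt0.
- move=> i x Bx; rewrite /p /rk; have [Sx|nSx] := boolP (x \in S).
    by have [Sp ?] := F1 i.1 x Sx; rewrite Sp; split=> //; exact: (subsetP sSB).
  have [Sp ?] := F2 i.2 x (BS x Bx nSx); rewrite (BSN _ Sp); split=> //.
  exact: (subsetP sDB).
- move=> i g x lg Bx; rewrite /p /h; have [Sx|nSx] := boolP (x \in S).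
    by rewrite F1S //; apply: L1 => //; exact: lip_sub lg.
  rewrite (BSN _ (F2S _ _ (BS _ Bx nSx))); apply: L2 => //; last exact: BS.
  exact: lip_sub lg.
- move=> i x y Bx By exy; rewrite /h /b -(eS x y) //; have [Sx|nSx] := boolP (x \in S).
    have Sy : y \in S by rewrite -(eS x y).
    have [z [xz yz le]] := A1 i.1 x y Sx Sy exy.
    have ep : {in S, p1 i.1 =1 p i} by move=> t; rewrite /p => ->.
    exists z; rewrite (forest_anc (F1 i.1) Sx xz); split=> //.
      exact: (fconnect_eq_in (F1 i.1) ep Sx).
    exact: (fconnect_eq_in (F1 i.1) ep Sy).
  have nSy : y \notin S by rewrite -(eS x y).
  have DSx := BS x Bx nSx; have DSy := BS y By nSy.
  have [z [xz yz le]] := A2 i.2 x y DSx DSy exy.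
  have ep : {in B :\: S, p2 i.2 =1 p i} by move=> t /BSN; rewrite /p => ->.
  exists z; rewrite (BSN _ (forest_anc (F2 i.2) DSx xz)); split=> //.
    exact: (fconnect_eq_in (F2 i.2) ep DSx).
  exact: (fconnect_eq_in (F2 i.2) ep DSy).
- move=> x y Bx By exy; rewrite card_prod natrM; have [Sx|nSx] := boolP (x \in S).
    rewrite (eq_bigr (fun i : I1 * I2 => b1 i.1 x y)) => [|i _]; last by rewrite /b Sx.
    rewrite -(pair_big xpredT xpredT (fun i1 (i2 : I2) => b1 i1 x y)) /=.
    under eq_bigr do rewrite sumr_const -mulr_natr.
    rewrite -mulr_suml mulrA ler_wpM2r //; apply: E1 => //.
    by rewrite -(eS x y).
  rewrite (eq_bigr (fun i : I1 * I2 => b2 i.2 x y)) => [|i _]; last by rewrite /b (negbTE nSx).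
  rewrite -(pair_big xpredT xpredT (fun (i1 : I1) i2 => b2 i2 x y)) /=.
  rewrite sumr_const -[leLHS]mulr_natr mulrA [leRHS]mulrAC ler_wpM2r //.
  by apply: E2 => //; apply: BS => //; rewrite -(eS x y).
Qed.

End Geodesics.

(** * Cutting a forest and hanging its pieces on a geodesic *)

(** Hermite's identity at [a / N]: averaged over the offsets, the window index of [a] is exactly
    [a / N]. *)
Lemma sum_divn_shift N a : (0 < N)%N -> (\sum_(t < N) (a + t) %/ N = a)%N.
Proof.
move=> N_gt0; elim: a => [|a IHa].
  by rewrite big1 // => t _; rewrite add0n divn_small.
case: N N_gt0 IHa => // N _ IHa; rewrite big_ord_recr /= addSnnS divnDr //.
rewrite divnn /= addnA addn1; congr S; rewrite -[RHS]IHa big_ord_recl /= addn0 addnC.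
by congr (_ + _)%N; apply: eq_bigr => t _; rewrite addSnnS.
Qed.

(** Every offset that separates [a] from [b] adds at least 1 to the difference of their two sums in
    [sum_divn_shift]. *)
Lemma card_divn_shift_neq N a b : (0 < N)%N -> (b <= a)%N ->
  (#|[pred t : 'I_N | (a + t) %/ N != (b + t) %/ N]| <= a - b)%N.
Proof.
move=> N_gt0 leba; rewrite leq_subRL // -{1}(sum_divn_shift b N_gt0).
rewrite -{2}(sum_divn_shift a N_gt0) -sum1_card [X in (_ + X)%N]big_mkcond -big_split /=.
apply: leq_sum => t _; rewrite inE; have : ((b + t) %/ N <= (a + t) %/ N)%N.
  by rewrite leq_div2r // leq_add2r.
move: ((a + t) %/ N)%N ((b + t) %/ N)%N => u v; case: eqVneq => [->|] /=; lia.
Qed.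

Lemma divn_shift_eq N a b t : (0 < N)%N -> ((a + t) %/ N = (b + t) %/ N)%N -> (a < b + N)%N.
Proof.
move=> N_gt0 eq; rewrite -(ltn_add2r t) (divn_eq (a + t) N) eq addnAC.
by rewrite [X in (_ < X + _)%N](divn_eq (b + t) N) -addnA ltn_add2l ltn_addl // ltn_pmod.
Qed.

Section Reattach.
Variables (R : realType) (V : finType) (e : rel V) (w : V -> V -> R).
Hypotheses (e_sym : symmetric e) (w_sym : forall x y, w x y = w y x).
Hypothesis w_ge0 : forall x y, e x y -> 0 <= w x y.
Notation lip := (lip e w).

Variables (B A : {set V}) (pA : V -> V) (rkA : V -> nat) (f : V -> R).
Hypothesis geoA : geodesic e w B A pA rkA f.
Variables (d : V -> R) (a : V -> V).
Hypotheses (lip_d : lip B d) (dA : forall x, x \in A -> d x = 0).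
Hypothesis near : forall x, x \in B ->
  [/\ a x \in A, 0 <= d x & forall g, lip B g -> `|g x - g (a x)| <= d x].

Variables (p : V -> V) (rk : V -> nat) (h : V -> R).
Hypothesis fC : forest (B :\: A) p rk.
Hypothesis domC : forall g x, lip (B :\: A) g -> x \in B :\: A ->
  `|g x - g (p x)| <= h x - h (p x).

(* [K] is an integer version of the integral of [2 N / d] along the paths from
   the roots.  Cutting it into windows of length [N] leaves pieces in which [d]
   varies by a bounded factor, and cuts an edge of length [l] with probability
   [O(l / d)] for a random offset [t]. *)
Variables (N : nat) (K : V -> nat).
Hypothesis N_gt0 : (0 < N)%N.
Hypothesis K_mono : forall x, x \in B :\: A -> (K (p x) <= K x)%N.
Hypothesis K_ge : forall x, x \in B :\: A -> (K x < K (p x) + N)%N ->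
  N%:R * 2 * (h x - h (p x)) <= ((K x)%:R - (K (p x))%:R) * d x.
Hypothesis K_le : forall x, x \in B :\: A ->
  ((K x)%:R - (K (p x))%:R) * d x <= N%:R * 4 * (h x - h (p x)).

Let sCB : B :\: A \subset B := subsetDl _ _.

Let CB x : x \in B :\: A -> x \in B. Proof. exact: (subsetP sCB). Qed.

Let CA x : x \in B :\: A -> (x \in A) = false.
Proof. by rewrite in_setD => /andP[/negbTE]. Qed.

Let Cp x : x \in B :\: A -> p x \in B :\: A. Proof. by case/fC. Qed.

Let sAB : A \subset B. Proof. by case: geoA. Qed.

Let lip_f : lip B f. Proof. by case: geoA. Qed.

Let dom_lip g x : lip B g -> x \in B :\: A -> `|g x - g (p x)| <= h x - h (p x).
Proof. by move=> lg; apply: domC; exact: lip_sub lg. Qed.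

Let h_mono x : x \in B :\: A -> h (p x) <= h x.
Proof.
move=> Cx; have := domC (g := fun=> 0) _ Cx; rewrite subrr normr0 subr_ge0; apply.
by move=> y z _ _ /w_ge0; rewrite subrr.
Qed.

Let K_anc x z : x \in B :\: A -> fconnect p x z -> (K z <= K x)%N.
Proof.
apply: (forest_anc_rel (r := fun x z => (K z <= K x)%N) fC) => // u v y le1 le2.
exact: leq_trans le2 le1.
Qed.

Let h_anc x z : x \in B :\: A -> fconnect p x z -> h z <= h x.
Proof.
apply: (forest_anc_rel (r := fun x z => h z <= h x) fC) => // u v y le1 le2.
exact: le_trans le2 le1.
Qed.

(** [K_le] is summed up the path: on the way to [z], [d] falls by at most [h x - h z], so it stays
    at least [m]. *)
Lemma K_anc_bound x z m : x \in B :\: A -> fconnect p x z ->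
  0 <= m -> m + (h x - h z) <= d x ->
  ((K x)%:R - (K z)%:R) * m <= N%:R * 4 * (h x - h z).
Proof.
move=> Cx /iter_findex <- m0; move: (findex p x z) => n {z}.
elim: n x Cx => [|n IHn] x Cx; first by rewrite /= !subrr mul0r mulr0.
rewrite iterSr => le.
have le1 : m + (h (p x) - h (iter n p (p x))) <= d (p x).
  by have := dom_lip lip_d Cx; rewrite ler_norml => /andP[]; lra.
have lemd : m <= d x.
  by have := h_anc Cx (fconnect_iter p n.+1 x); rewrite iterSr; lra.
have := IHn (p x) (Cp Cx) le1; have := K_le Cx.
have : ((K x)%:R - (K (p x))%:R) * m <= ((K x)%:R - (K (p x))%:R) * d x.
  by rewrite ler_wpM2l // subr_ge0 ler_nat K_mono.
by lra.
Qed.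

Let dom_anc g x z : lip B g -> x \in B :\: A -> fconnect p x z ->
  `|g x - g z| <= h x - h z.
Proof.
move=> lg; apply: (forest_anc_rel (r := fun x z => `|g x - g z| <= h x - h z) fC).
- by move=> u; rewrite /= !subrr normr0.
- by move=> u v y; rewrite !ler_norml => /andP[? ?] /andP[? ?]; apply/andP; split; lra.
- by move=> y; exact: dom_lip.
Qed.

Lemma card_cut_bound x y z : x \in B :\: A -> y \in B :\: A ->
  fconnect p x z -> fconnect p y z ->
  #|[pred t : 'I_N | ((K x + t) %/ N != (K z + t) %/ N)%N
                  || ((K y + t) %/ N != (K z + t) %/ N)%N]|%:R * d x <=
    N%:R * 8 * (h x + h y - h z *+ 2).
Proof.
move=> Cx Cy xz yz; set c := #|_|; set b := h x + h y - _.
have [hxz hyz] := (h_anc Cx xz, h_anc Cy yz).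
have [_ dx0 _] := near (CB Cx).
have cK : c%:R <= ((K x)%:R - (K z)%:R) + ((K y)%:R - (K z)%:R) :> R.
  have [Kxz Kyz] := (K_anc Cx xz, K_anc Cy yz).
  rewrite -!natrB // -natrD ler_nat.
  apply: leq_trans (leq_add (card_divn_shift_neq N_gt0 Kxz) (card_divn_shift_neq N_gt0 Kyz)).
  by rewrite -cardUI (leq_trans _ (leq_addr _ _)) // subset_leq_card //; apply/subsetP.
have cN : c%:R <= N%:R :> R by rewrite ler_nat -[leqRHS]card_ord max_card.
have b0 : 0 <= b by rewrite /b; lra.
have N0 : 0 < N%:R :> R by rewrite ltr0n.
(* If [d x <= 4 * b], the trivial bound [c <= N] suffices. Otherwise [d x - 2 * b] is a lower bound
   for [d] on both halves of the path from [x] to [y], and it is at least [d x / 2]; this half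
   doubles the 4 of [K_le] to 8. *)
have [le|lt] := leP (d x) (4 * b).
  have : c%:R * d x <= N%:R * d x by rewrite ler_wpM2r.
  have : N%:R * d x <= N%:R * (4 * b) by rewrite ler_wpM2l // ltW.
  by have := mulr_ge0 (ltW N0) b0; lra.
have m0 : 0 <= d x - 2 * b by lra.
have dxz := dom_anc lip_d Cx xz; have dyz := dom_anc lip_d Cy yz.
move: dxz dyz; rewrite !ler_norml => /andP[? ?] /andP[? ?].
have K1 : ((K x)%:R - (K z)%:R) * (d x - 2 * b) <= N%:R * 4 * (h x - h z).
  by apply: K_anc_bound => //; rewrite /b; lra.
have K2 : ((K y)%:R - (K z)%:R) * (d x - 2 * b) <= N%:R * 4 * (h y - h z).
  by apply: K_anc_bound => //; rewrite /b; lra.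
have : c%:R * (d x - 2 * b) <= N%:R * 4 * b.
  by apply: le_trans (ler_wpM2r m0 cK) _; rewrite mulrDl (le_trans (lerD K1 K2)) // /b; lra.
have : c%:R * (d x / 2) <= c%:R * (d x - 2 * b) by rewrite ler_wpM2l //; lra.
by lra.
Qed.

Variable t : nat.

Let lev x := ((K x + t) %/ N)%N.
(** Roots of the old forest count as cut, because they too must be hung on [A]. *)
Let cut x := (p x == x) || (lev x != lev (p x)).
Let p' x := if x \in A then pA x else if cut x then a x else p x.
Let rk' x := if x \in A then rkA x else (\max_y rkA y + rk x).+1.
Let len' x := if x \in A then f x - f (pA x) else if cut x then d x else h x - h (p x).

Lemma reattach_forest : forest B p' rk'.
Proof.
case: geoA => _ fA _ _ _ x Bx; rewrite /p' /rk'; case: ifPn => Ax.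
  by have [Apx le] := fA x Ax; rewrite Apx (subsetP sAB).
have Cx : x \in B :\: A by rewrite in_setD Ax.
case: ifPn => [_|]; first have [Aa _ _] := near Bx.
  rewrite Aa (subsetP sAB) //; split=> //; right.
  by rewrite ltnS (leq_trans (leq_bigmax _)) ?leq_addr.
rewrite negb_or => /andP[/eqP npx _]; have [Cpx [//|lt]] := fC Cx.
by rewrite CA // CB //; split=> //; right; rewrite ltnS ltn_add2l.
Qed.

Lemma reattach : exists p' rk' (h' : V -> R), [/\
  forest B p' rk',
  forall g x, lip B g -> x \in B -> `|g x - g (p' x)| <= h' x - h' (p' x),
  forall x z, x \in B :\: A -> fconnect p x z ->
    ((K x + t) %/ N = (K z + t) %/ N)%N -> fconnect p' x z /\ h' x - h' z = h x - h z &
  forall x y, x \in B -> y \in B -> e x y -> exists z,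
    [/\ fconnect p' x z, fconnect p' y z &
        h' x + h' y - h' z *+ 2 <= w x y + 6 * d x + 6 * d y]].
Proof.
have fB := reattach_forest.
have [h' h'E] := forest_rec f (fun x v => v + len' x) fB.
exists p', rk', h'; have [_ fA _ domA chainA] := geoA.
have h'A : forall x, x \in A -> h' x = f x.
  apply: (forest_ind fA) => x Ax IH; rewrite h'E ?(subsetP sAB) // /p' /len' Ax.
  by case: eqP => // /eqP npx; rewrite IH // addrC subrK.
have h'cut x : x \in B :\: A -> cut x -> h' x = f (a x) + d x.
  move=> Cx cx; have [Aa _ _] := near (CB Cx).
  rewrite h'E ?CB // /p' /len' CA // cx h'A //; case: eqP => // ax.
  by have := CA Cx; rewrite -ax Aa.
have h'unc x : x \in B :\: A -> ~~ cut x -> h' x = h' (p x) + (h x - h (p x)).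
  move=> Cx ncx; rewrite h'E ?CB // /p' /len' CA // (negbTE ncx).
  by move: ncx; rewrite /cut negb_or => /andP[/negbTE->].
have p'unc x : x \in B :\: A -> ~~ cut x -> p' x = p x.
  by move=> Cx ncx; rewrite /p' CA // (negbTE ncx).
split=> //.
- move=> g x lg Bx; have [Ax|nAx] := boolP (x \in A).
    have Apx : pA x \in A by case: (fA x Ax).
    by rewrite /p' Ax !h'A //; apply: domA.
  have Cx : x \in B :\: A by rewrite in_setD nAx.
  have [cx|ncx] := boolP (cut x).
    have [Aa _ near_x] := near Bx.
    by rewrite h'cut // /p' CA // cx h'A // [f _ + _]addrC addrK near_x.
  by rewrite p'unc // h'unc // [h' _ + _]addrC addrK dom_lip.
- move=> x z Cx /iter_findex <-; move: (findex p x z) => n {z}.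
  elim: n x Cx => [|n IHn] x Cx; first by move=> _; rewrite /= !subrr; split=> //; exact: connect0.
  rewrite iterSr; have [epx|npx] := eqVneq (p x) x; first by rewrite epx; exact: IHn.
  move=> lxz; have Cpx := Cp Cx.
  have lpx : lev (p x) = lev (iter n p (p x)).
    apply/eqP; rewrite eqn_leq /lev -{1}lxz !leq_div2r ?leq_add2r ?K_mono //.
    by apply: K_anc => //; exact: fconnect_iter.
  have ncx : ~~ cut x by rewrite /cut negb_or npx lpx negbK; apply/eqP.
  have [c1 e1] := IHn (p x) Cpx lpx; split.
    by apply: connect_trans c1; rewrite -p'unc //; exact: fconnect1.
  by rewrite h'unc //; lra.
(* Climbing from [x] to the top of its piece costs at most [d x]; meanwhile [d] at most doubles, so
   the edge to [A] costs at most [2 * d x]. *)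
have attach x : x \in B -> exists q, [/\ q \in A, fconnect p' x q,
    h' x - f q <= 3 * d x & `|f q - f x| <= 3 * d x].
  move=> Bx; have [Ax|nAx] := boolP (x \in A).
    by exists x; rewrite connect0 h'A // !subrr normr0 dA // mulr0.
  have Cx : x \in B :\: A by rewrite in_setD nAx.
  have [_ dx _] := near Bx.
  (* The invariant of the climb, at a vertex [y] in the piece of [x]. Within a window [K] varies by
     less than [N], so the fourth clause yields [h x - h y <= d x], hence [d y <= 2 * d x]; the
     factor 2 in [K_ge] absorbs this when the clause is carried one step further. *)
  pose reach y := [/\ fconnect p' x y, h' x - h' y = h x - h y, lev x = lev y /\ (K y <= K x)%N,
    N%:R * (h x - h y) <= ((K x)%:R - (K y)%:R) * d x &
    `|f x - f y| <= h x - h y /\ `|d x - d y| <= h x - h y].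
  have near_reach y : y \in B :\: A -> reach y -> h x - h y <= d x.
    move=> Cy [_ _ [lxy leK] le _].
    have ltK : ((K x)%:R - (K y)%:R) * d x <= N%:R * d x.
      by rewrite ler_wpM2r // lerBlDr -natrD ler_nat addnC ltnW // (divn_shift_eq N_gt0 lxy).
    by rewrite -(ler_pM2l (x := N%:R)) ?ltr0n //; lra.
  suff : forall y, y \in B :\: A -> reach y -> exists q, [/\ q \in A, fconnect p' x q,
      h' x - f q <= 3 * d x & `|f q - f x| <= 3 * d x].
    by move/(_ x Cx); apply; split; rewrite ?connect0 ?subrr ?normr0 ?mulr0 ?mul0r ?leqnn //.
  apply: (forest_ind fC) => y Cy IH ry; have hxy := near_reach y Cy ry.
  have [cxy hE [lxy leK] le [lef led]] := ry.
  have [Aay dy /(_ f lip_f) fay] := near (CB Cy).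
  move: lef led fay; rewrite !ler_norml => /andP[lef1 lef2] /andP[led1 led2] /andP[fay1 fay2].
  have [cy|ncy] := boolP (cut y).
    exists (a y); split=> //.
    - by apply: connect_trans cxy _; rewrite -[a y](_ : p' y = _) ?fconnect1 // /p' CA // cy.
    - by move: hE; rewrite (h'cut y) //; lra.
    - by rewrite ler_norml; apply/andP; split; lra.
  have npy : p y != y by move: ncy; rewrite /cut negb_or => /andP[].
  have lpy : lev y = lev (p y) by move: ncy; rewrite /cut negb_or negbK => /andP[_ /eqP].
  apply: IH => //; split.
  - by apply: connect_trans cxy _; rewrite -p'unc //; exact: fconnect1.
  - by move: hE; rewrite (h'unc y) //; lra.
  - by rewrite lxy lpy (leq_trans (K_mono Cy)).
  - have := K_ge Cy (divn_shift_eq N_gt0 lpy).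
    have : ((K y)%:R - (K (p y))%:R) * d y <= ((K y)%:R - (K (p y))%:R) * (2 * d x).
      by rewrite ler_wpM2l ?subr_ge0 ?ler_nat ?K_mono //; lra.
    by lra.
  - have := dom_lip lip_f Cy; have := dom_lip lip_d Cy; rewrite !ler_norml.
    by move=> /andP[? ?] /andP[? ?]; split; apply/andP; split; lra.
move=> x y Bx By exy; have [q [Aq xq hxq]] := attach x Bx; have [s [As ys hys]] := attach y By.
have := lip_norm e_sym w_sym lip_f Bx By exy; rewrite !ler_norml => /andP[? ?].
move=> /andP[? ?] /andP[? ?].
have p'A : {in A, pA =1 p'} by move=> z Az; rewrite /p' Az.
have f_anc q1 q2 : q1 \in A -> fconnect pA q1 q2 -> f q2 <= f q1.
  apply: (forest_anc_rel (r := fun x z => f z <= f x) fA) => // [u v s' le1 le2|u Au].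
    exact: le_trans le2 le1.
  have := domA u (fun=> 0) Au; rewrite subrr normr0 subr_ge0; apply.
  by move=> u' v _ _ /w_ge0; rewrite subrr.
(* In the tree the attachment points are [|f q - f s|] apart, at most [w x y + 3 * d x + 3 * d y];
   the two climbs contribute as much in [d] again. *)
have [qs|sq] := chainA q s Aq As.
  exists s; split=> //; last by rewrite (h'A s) //; lra.
  exact: connect_trans xq (fconnect_eq_in fA p'A Aq qs).
exists q; split=> //; last by rewrite (h'A q) //; lra.
exact: connect_trans ys (fconnect_eq_in fA p'A As sq).
Qed.

End Reattach.

(** [k] is [2 * N * l / d] rounded up, and [N] is so large that [d <= N * l] whenever [l] is
    positive, so rounding stays below the factor 4. When [d <= 4 * l], the increment is [N], which
    means a cut at every offset. *)
Lemma discretize (R : realType) (I : finType) (l d : I -> R) :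
  (forall i, 0 <= l i) -> (forall i, 0 <= d i) ->
  exists (N : nat) (k : I -> nat), (0 < N)%N /\ forall i,
    (k i)%:R * d i <= N%:R * 4 * l i /\
    ((k i < N)%N -> N%:R * 2 * l i <= (k i)%:R * d i).
Proof.
move=> l0 d0; pose N := (\max_i Num.truncn (d i / l i)).+1.
exists N, (fun i => if l i == 0 then 0%N else
  if d i <= 4 * l i then N else (Num.truncn (N%:R * 2 * l i / d i)).+1).
split=> // i /=; case: eqP => [->|/eqP nl]; first by rewrite !mulr0 mul0r.
have lt0 : 0 < l i by rewrite lt_neqAle eq_sym nl l0.
case: (leP (d i) (4 * l i)) => [le|lt]; first by rewrite ltnn -mulrA ler_wpM2l.
have dlt0 : 0 < d i by lra.
have dN : d i <= N%:R * l i.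
  rewrite -ler_pdivrMr // (le_trans (ltW (truncnS_gt _))) // ler_nat ltnS.
  exact: (leq_bigmax (F := fun i => Num.truncn (d i / l i))).
set q := _ / d i; have qd : q * d i = N%:R * 2 * l i by rewrite divfK // gt_eqF.
have q0 : 0 <= q by apply: divr_ge0; rewrite ?mulr_ge0 ?ler0n ?l0 ?d0.
have lt1 := truncnS_gt q; have le1 : (Num.truncn q)%:R <= q by rewrite truncn_le.
rewrite -natr1 in lt1 *; split=> [|_].
  have : ((Num.truncn q)%:R + 1) * d i <= (q + 1) * d i by rewrite ler_wpM2r // lerD2r.
  by lra.
by rewrite -qd ler_wpM2r // ltW.
Qed.

(** * The induction on the width *)

Section InductionStep.
Variables (R : realType) (V : finType) (e : rel V) (w : V -> V -> R).
Hypotheses (e_sym : symmetric e) (w_sym : forall x y, w x y = w y x).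
Hypothesis w_ge0 : forall x y, e x y -> 0 <= w x y.
Implicit Types (A B C S U : {set V}) (f g : V -> R).
Notation lip := (lip e w).
Notation tree_approx := (tree_approx e w).

(** At a bad offset an edge is stretched to at most [w x y + 6 * d x + 6 * d y <= 12 * d x + 7 * w x
    y], and the number of bad offsets times [d x] is at most [8 * N * b]. The average is thus at
    most [b + 96 * b + 7 * w x y]. If an end lies on [A], then [d] is 0 there and at most [w x y] at
    the other end, so [7 * w x y] is enough. *)
Lemma tree_approx_geodesic D B A pA rkA f : 0 <= D -> conn e B -> A != finset.set0 ->
  geodesic e w B A pA rkA f -> tree_approx D (B :\: A) ->
  tree_approx (97 * D + 7) B.
Proof.
move=> D0 cB A0 geoA [I [p [rk [h [b [I_gt0 fC domC ancC expC]]]]]].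
have [sAB _ lip_f _ _] := geoA.
have [d [a [lip_d dA near]]] := nearest_point e_sym w_sym w_ge0 cB sAB A0.
(* A single [N] serves all forests, so that forest and offset are uniform on the product [I * 'I_N].
   The norms supply nonnegative data where no sign is known. *)
have [N [k [N_gt0 kP]]] := @discretize R (I * V)%type
  (fun q => `|h q.1 q.2 - h q.1 (p q.1 q.2)|) (fun q => `|d q.2|)
  (fun=> normr_ge0 _) (fun=> normr_ge0 _).
have h_mono i x : x \in B :\: A -> h i (p i x) <= h i x.
  move=> Cx; rewrite -subr_ge0 (le_trans _ (domC i (fun=> 0) x _ Cx)) // => y z _ _ /w_ge0.
  by rewrite subrr.
have Kex i := forest_rec (fun=> 0%N) (fun x v => v + k (i, x))%N (fC i).
have [K KE] := choice Kex.
have h_anc i x v : x \in B :\: A -> fconnect (p i) x v -> h i v <= h i x.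
  apply: (forest_anc_rel (r := fun x v => h i v <= h i x) (fC i)) => // [u u' y le1 le2|y].
    exact: le_trans le2 le1.
  exact: h_mono.
have CB x : x \in B :\: A -> x \in B by apply: (subsetP (subsetDl _ _)).
have d_ge0 x : x \in B -> 0 <= d x by case/near.
have KP i x : x \in B :\: A ->
    K i x = (K i (p i x) + if p i x == x then 0 else k (i, x))%N.
  by move=> Cx; case: eqP => [->|np]; [rewrite addn0|rewrite KE //; case: eqP].
have kiP i x : x \in B :\: A -> let l := h i x - h i (p i x) in
    (k (i, x))%:R * d x <= N%:R * 4 * l /\
    ((k (i, x) < N)%N -> N%:R * 2 * l <= (k (i, x))%:R * d x).
  move=> Cx; have := kP (i, x); rewrite /= (ger0_norm (d_ge0 x (CB x Cx))).
  by rewrite ger0_norm // subr_ge0 h_mono.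
have K_mono i x : x \in B :\: A -> (K i (p i x) <= K i x)%N.
  by move=> Cx; rewrite [leqRHS]KP // leq_addr.
have K_ge i x : x \in B :\: A -> (K i x < K i (p i x) + N)%N ->
    N%:R * 2 * (h i x - h i (p i x)) <= ((K i x)%:R - (K i (p i x))%:R) * d x.
  move=> Cx; rewrite [K i x]KP // natrD [_ + _ - _]addrAC subrr add0r ltn_add2l.
  case: eqP => [->|_]; first by rewrite subrr mulr0 mul0r.
  exact: (kiP i x Cx).2.
have K_le i x : x \in B :\: A ->
    ((K i x)%:R - (K i (p i x))%:R) * d x <= N%:R * 4 * (h i x - h i (p i x)).
  move=> Cx; rewrite [K i x]KP // natrD [_ + _ - _]addrAC subrr add0r.
  case: eqP => [->|_]; first by rewrite subrr mulr0 mul0r.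
  exact: (kiP i x Cx).1.
have re (q : I * 'I_N) := reattach e_sym w_sym w_ge0 geoA lip_d dA near (fC q.1) (@domC q.1)
  N_gt0 (@K_mono q.1) (@K_ge q.1) q.2.
have [p' {}re] := choice re; have [rk' {}re] := choice re; have [h' {}re] := choice re.
have zP (q : I * V * V) : exists z, q.1.2 \in B :\: A -> q.2 \in B :\: A -> e q.1.2 q.2 ->
    [/\ fconnect (p q.1.1) q.1.2 z, fconnect (p q.1.1) q.2 z &
      h q.1.1 q.1.2 + h q.1.1 q.2 - h q.1.1 z *+ 2 <= b q.1.1 q.1.2 q.2].
  have [[Cx Cy exy]|no] :=
      pselect [/\ q.1.2 \in B :\: A, q.2 \in B :\: A & e q.1.2 q.2].
    by have [z Hz] := ancC q.1.1 _ _ Cx Cy exy; exists z.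
  by exists q.2 => Cx Cy exy; case: no.
have {zP} [z zP] := choice zP.
pose bad (q : I * 'I_N) x y (t := q.2 : nat) :=
  ((K q.1 x + t) %/ N != (K q.1 (z (q.1, x, y)) + t) %/ N)%N ||
  ((K q.1 y + t) %/ N != (K q.1 (z (q.1, x, y)) + t) %/ N)%N.
pose inC x y := (x \in B :\: A) && (y \in B :\: A).
pose b' (q : I * 'I_N) x y := if inC x y
  then b q.1 x y + (bad q x y)%:R * (12 * d x + 7 * w x y) else 7 * w x y.
have d_lip x y : x \in B -> y \in B -> e x y -> d y <= d x + w x y.
  by move=> Bx By exy; rewrite -lerBlDl w_sym lip_d // e_sym.
exists (I * 'I_N)%type, p', rk', h', b'; split.
- by rewrite card_prod card_ord muln_gt0 I_gt0.
- by move=> q; case: (re q).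
- by move=> q; case: (re q).
- move=> q x y Bx By exy; have [_ _ keep new] := re q.
  have [z' [xz' yz' le']] := new x y Bx By exy.
  have dyx := d_lip x y Bx By exy; have w0 := w_ge0 exy.
  rewrite /b' /inC; case: ifPn => [/andP[Cx Cy]|nC]; last first.
    exists z'; split=> //; apply: le_trans le' _.
    have dxy : d x <= d y + w x y by rewrite w_sym; apply: d_lip; rewrite // e_sym.
    have [dx0|dy0] : d x = 0 \/ d y = 0.
      by move: nC; rewrite !in_setD Bx By !andbT negb_and !negbK => /orP[/dA|/dA]; [left|right].
    - by lra.
    - by lra.
  have [xz yz le] := zP (q.1, x, y) Cx Cy exy.
  have [badq|] := boolP (bad q x y).
    exists z'; split=> //; have b0 : 0 <= b q.1 x y.
      by apply: le_trans le; have := (h_anc _ _ _ Cx xz, h_anc _ _ _ Cy yz) => -[/=]; lra.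
    by rewrite mulr1n mul1r; lra.
  rewrite negb_or !negbK => /andP[/eqP lx /eqP ly].
  have [xz1 hx] := keep x _ Cx xz lx; have [yz1 hy] := keep y _ Cy yz ly.
  by exists (z (q.1, x, y)); rewrite mulr0n mul0r; split=> //; move: le => /=; lra.
- move=> x y Bx By exy; rewrite card_prod card_ord natrM.
  have w0 := w_ge0 exy; have N0 : 0 < N%:R :> R by rewrite ltr0n.
  have Dw : 0 <= D * w x y * (#|I|%:R * N%:R) by rewrite !mulr_ge0.
  have [/andP[Cx Cy]|nC] := boolP (inC x y); last first.
    rewrite (eq_bigr (fun=> 7 * w x y)) => [|q _]; last by rewrite /b' (negbTE nC).
    rewrite sumr_const card_prod card_ord -[leLHS]mulr_natr natrM.
    by have := Dw; lra.
  have sumb i : \sum_(t < N) b' (i, t) x y <= N%:R * (97 * b i x y + 7 * w x y).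
    have [xz yz le] := zP (i, x, y) Cx Cy exy.
    rewrite (eq_bigr (fun t => b i x y + (bad (i, t) x y)%:R * (12 * d x + 7 * w x y))); last first.
      by move=> t _; rewrite /b' /inC Cx Cy.
    rewrite big_split /= sumr_const card_ord -mulr_suml -natr_sum.
    have -> : (\sum_(t < N) bad (i, t) x y)%N = #|[pred t : 'I_N | bad (i, t) x y]|.
      by rewrite -sum1_card [RHS]big_mkcond; apply: eq_bigr => t _; rewrite inE; case: (bad _ _ _).
    have cN : #|[pred t : 'I_N | bad (i, t) x y]|%:R <= N%:R :> R.
      by rewrite ler_nat -[leqRHS]card_ord max_card.
    have := card_cut_bound w_ge0 lip_d near (fC i) (@domC i) N_gt0
      (@K_mono i) (@K_le i) Cx Cy xz yz.
    rewrite -/(bad (i, _) x y); move: cN; rewrite -[b i x y *+ N]mulr_natl.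
    move: #|_|%:R => c cN cd.
    have : c * w x y <= N%:R * w x y by rewrite ler_wpM2r.
    have : N%:R * 8 * (h i x + h i y - h i (z (i, x, y)) *+ 2) <= N%:R * 8 * b i x y.
      by rewrite ler_wpM2l ?mulr_ge0.
    by move: cd; lra.
  rewrite (eq_bigr (fun q => b' (q.1, q.2) x y)) => [|[i t] _ //].
  rewrite -(pair_big xpredT xpredT (fun i t => b' (i, t) x y)) /=.
  apply: (@le_trans _ _ (\sum_i N%:R * (97 * b i x y + 7 * w x y))).
    by apply: ler_sum => i _; exact: sumb.
  rewrite -mulr_sumr big_split -mulr_sumr /= sumr_const -[_ *+ _]mulr_natr.
  have := ler_wpM2l (ltW N0) (expC x y Cx Cy exy).
  by have := w0; lra.
Qed.

End InductionStep.

Lemma interval_rep_sub (V : finType) (e : rel V) k (B C : {set V}) l r :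
  C \subset B -> interval_rep e k B l r -> interval_rep e k C l r.
Proof.
move=> /subsetP sCB [lr ov bags]; split=> [x /sCB/lr//|x y /sCB Bx /sCB By|t].
  exact: ov.
apply: leq_trans (bags t); apply/subset_leq_card/subsetP => x.
by rewrite !inE => /andP[/sCB ->].
Qed.

Theorem tree_approx_interval_rep (R : realType) (k : nat) :
  exists2 D : R, 0 <= D & forall (V : finType) (e : rel V) (w : V -> V -> R),
    symmetric e -> (forall x y, w x y = w y x) ->
    (forall x y, e x y -> 0 <= w x y) ->
    forall B l r, interval_rep e k B l r -> tree_approx e w D B.
Proof.
elim: k => [|k [D D0 IHk]].
  exists 0 => // V e w e_sym w_sym w_ge0 B l r [lr _ bags].
  suff -> : B = finset.set0 by exact: tree_approx0.
  apply/setP => x; rewrite [RHS]inE; apply/negP => Bx; have := bags (l x).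
  rewrite leqn0 cards_eq0 => /eqP/setP/(_ x).
  by rewrite !inE Bx leqnn lr.
exists (97 * D + 7) => [|V e w e_sym w_sym w_ge0 B l r]; first by lra.
(* Geodesics are available only in connected sets; an inner induction on the size of [B] splits off
   components at no cost in the constant. *)
have [n] := ubnP #|B|; elim: n B => // n IHn B ltBn rep.
have [->|B0] := eqVneq B finset.set0; first exact: tree_approx0.
have [cB|ncB] := pselect (conn e B).
  have [A [pA [rkA [f [A0 geoA repC]]]]] := geodesic_exists e_sym w_sym w_ge0 cB B0 rep.
  apply: (tree_approx_geodesic e_sym w_sym w_ge0 D0 cB A0 geoA).
  exact: IHk repC.
have [S [x [Sx Bx clS nsub]]] : exists (S : {set V}) x,
    [/\ x \in S, x \in B, closed_in e B S & ~~ (B \subset S)].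
  apply: contrapT => no; apply: ncB => S x Sx Bx clS; apply/negPn/negP => nsub.
  by apply: no; exists S, x.
have sSB : B :&: S \subset B := subsetIl _ _.
have ltS (C : {set V}) : C \proper B -> tree_approx e w (97 * D + 7) C.
  move=> pC; apply: IHn; last exact: interval_rep_sub (proper_sub pC) rep.
  by rewrite -ltnS (leq_trans _ ltBn) // ltnS proper_card.
apply: (tree_approxU e_sym sSB).
- move=> u v; rewrite !in_setI => /andP[Bu Su] _ Bv euv.
  by rewrite Bv; exact: clS euv.
- apply: ltS; apply/properP; split=> //; case/subsetPn: nsub => y By nSy.
  by exists y => //; rewrite in_setI negb_and nSy orbT.
- apply: ltS; apply/properP; split; first exact: subsetDl.
  by exists x => //; rewrite in_setD in_setI Bx Sx.
Qed.

(** * Tree metrics and the random embedding *)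

(** An average of Dirac masses. It lives on [nat], where every set is measurable, so the random
    distances are measurable for free. *)
Lemma uniform_probability (R : realType) (n : nat) : (0 < n)%N ->
  exists P : probability nat R, forall f : nat -> \bar R, (forall i, (0 <= f i)%E) ->
    (\int[P]_i f i = (n%:R^-1)%:E * \sum_(i < n) f i)%E.
Proof.
move=> n0; have k0 : 0 <= n%:R^-1 :> R by rewrite invr_ge0.
pose m := mscale (NngNum k0) (msum (fun i => \d_i : {measure set nat -> \bar R}) n).
have m1 : m classical_sets.setT = 1%E.
  rewrite /m /mscale /= /msum (eq_bigr (fun=> 1%E)) => [|i _]; last exact: diracT.
  rewrite -(big_mkord xpredT (fun=> 1%E)) sumEFin sumr_const_nat subn0 -EFinM mulVf //.
  by rewrite pnatr_eq0 -lt0n.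
pose PP := Measure_isProbability.Build _ _ _ m m1.
pose P : probability nat R := HB.pack m PP.
exists P => f f0; rewrite /P /= /m ge0_integral_mscale //=.
rewrite ge0_integral_measure_sum //=; congr (_ * _)%E; apply: eq_bigr => i _.
rewrite integral_dirac //= -[RHS]mul1e; congr (_ * _)%E; exact: diracT.
Qed.

Section PathDist.
Variables (R : realType) (G : sgraph) (len : {set G} -> R).
Hypothesis len_ge0 : length_function len.
Implicit Types (x y z : G) (p q : seq G).

Lemma len_adj_ge0 x y : adj x y -> 0 <= len [set x; y].
Proof.
move=> axy; apply: len_ge0; rewrite inE; apply/existsP; exists x; apply/existsP.
by exists y; rewrite axy eqxx.
Qed.

Lemma walk_length_nil x : walk_length len x [::] = 0.
Proof. by rewrite /walk_length big_nil. Qed.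

Lemma walk_length_cons x y p :
  walk_length len x (y :: p) = len [set x; y] + walk_length len y p.
Proof. by rewrite /walk_length /= big_cons. Qed.

Lemma walk_length_cat x p q :
  walk_length len x (p ++ q) = walk_length len x p + walk_length len (last x p) q.
Proof.
elim: p x => [|y p IHp] x; first by rewrite walk_length_nil add0r.
by rewrite cat_cons !walk_length_cons IHp addrA.
Qed.

Lemma walk_length_ge0 x p : path (@adj G) x p -> 0 <= walk_length len x p.
Proof.
elim: p x => [|y p IHp] x /=; first by rewrite walk_length_nil.
by case/andP=> axy /IHp; rewrite walk_length_cons; apply: addr_ge0; exact: len_adj_ge0.
Qed.

Lemma rev_walk x p : path (@adj G) x p -> exists q,
  [/\ path (@adj G) (last x p) q, last (last x p) q = x &
      walk_length len (last x p) q = walk_length len x p].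
Proof.
elim: p x => [|y p IHp] x /=; first by exists [::].
case/andP=> axy /IHp[q [pq lq eq]]; exists (q ++ [:: x]).
rewrite cat_path last_cat walk_length_cat pq lq eq walk_length_cons /= adj_sym axy.
by rewrite walk_length_cons walk_length_nil addr0 addrC finset.setUC.
Qed.

Lemma path_dist_le x p : path (@adj G) x p ->
  (path_dist len x (last x p) <= (walk_length len x p)%:E)%E.
Proof. by move=> pp; apply: ereal_inf_lbound; exists p. Qed.

Lemma path_dist_ge x y (c : \bar R) :
  (forall p, path (@adj G) x p -> last x p = y -> (c <= (walk_length len x p)%:E)%E) ->
  (c <= path_dist len x y)%E.
Proof. by move=> H; apply/ereal_infP => _ [p [pp lp] <-]; exact: H. Qed.

Lemma path_dist_adj x y : adj x y -> (path_dist len x y <= (len [set x; y])%:E)%E.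
Proof.
move=> axy; have := @path_dist_le x [:: y]; rewrite /= axy => /(_ isT).
by rewrite walk_length_cons walk_length_nil addr0.
Qed.

Lemma path_dist_ge0 x y : (0 <= path_dist len x y)%E.
Proof. by apply: path_dist_ge => p pp _; rewrite lee_fin walk_length_ge0. Qed.

Lemma path_distxx x : path_dist len x x = 0%E.
Proof.
apply/eqP; rewrite eq_le path_dist_ge0 andbT.
by have := @path_dist_le x [::] isT; rewrite walk_length_nil.
Qed.

Lemma path_dist_sym x y : path_dist len x y = path_dist len y x.
Proof.
wlog suff le : x y / (path_dist len x y <= path_dist len y x)%E.
  by apply/eqP; rewrite eq_le !le.
apply: path_dist_ge => p /rev_walk[q [pq lq eq]] <-.
by have := path_dist_le pq; rewrite lq eq.
Qed.

Hypothesis cG : connected_graph G.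

Lemma path_dist_fin x y : path_dist len x y \is a fin_num.
Proof.
have /connectP[p pp ->] := cG x y; rewrite ge0_fin_numE ?path_dist_ge0 //.
exact: le_lt_trans (path_dist_le pp) (ltry _).
Qed.

Lemma path_dist_triangle x y z :
  (path_dist len x z <= path_dist len x y + path_dist len y z)%E.
Proof.
rewrite -leeBlDr ?path_dist_fin //; apply: path_dist_ge => p pp lp.
rewrite leeBlDr ?path_dist_fin // addeC -leeBlDr //; apply: path_dist_ge => q pq lq.
rewrite leeBlDr // -EFinD addrC -[in walk_length len y q]lp -walk_length_cat.
have ppq : path (@adj G) x (p ++ q) by rewrite cat_path pp lp.
by have := path_dist_le ppq; rewrite last_cat lp lq.
Qed.

Definition path_metric : fin_metric R :=
  FinMetric path_dist_ge0 path_distxx path_dist_sym path_dist_triangle.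

End PathDist.

(** * The weighted graph of a parent function *)

Section ForestGraph.
Variables (V : finType) (p : V -> V) (rk : V -> nat).

Definition parent_adj : rel V := fun x y => (x != y) && ((p x == y) || (p y == x)).

Lemma parent_adj_sym : symmetric parent_adj.
Proof. by move=> x y; rewrite /parent_adj eq_sym orbC. Qed.

Lemma parent_adj_irr : irreflexive parent_adj.
Proof. by move=> x; rewrite /parent_adj eqxx. Qed.

Definition parent_graph := SGraph parent_adj_sym parent_adj_irr.

Lemma fconnect_parent_adj x z : fconnect p x z -> connect parent_adj x z.
Proof.
apply: connect_sub => {}x {}z /eqP<-; have [<-|nx] := eqVneq x (p x); first exact: connect0.
by apply: connect1; rewrite /parent_adj nx eqxx.
Qed.

Hypothesis fp : forest [set: V] p rk.

(* The two neighbours on the cycle of a vertex of maximal rank would both be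
   its parent. *)
Lemma parent_graph_acyclic : acyclic_graph parent_graph.
Proof.
move=> c lt2c /andP[cyc uc].
have [x0 cx0] : exists x, x \in c by case: c lt2c {cyc uc} => // x c _; exists x; exact: mem_head.
have [x cx maxx] : exists2 x, x \in c & forall y, y \in c -> (rk y <= rk x)%N.
  by case: (arg_maxnP (P := mem c) rk cx0) => x; exists x.
have par y : y \in c -> parent_adj x y -> p x = y.
  move=> cy /andP[nxy /orP[/eqP//|/eqP pyx]].
  have [_ [epy|]] := fp (finset.in_setT y); first by rewrite -pyx epy eqxx in nxy.
  by rewrite pyx ltnNge maxx.
have nx : p x = next c x by apply: par; [rewrite mem_next|exact: next_cycle cyc cx].
have px : p x = prev c x.
  by apply: par; [rewrite mem_prev|rewrite parent_adj_sym; exact: prev_cycle cyc cx].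
have : next c x = prev c x by rewrite -nx px.
move/(congr1 (next c)); rewrite next_prev //.
case/rot_to: cx => i c' ec; rewrite -!(next_rot i uc) ec.
have : uniq (x :: c') by rewrite -ec rot_uniq.
have : (2 < size (x :: c'))%N by rewrite -ec size_rot.
case: c' {ec} => [|y [|z c']] //= _; rewrite !inE !negb_or => /andP[/andP[xy /andP[xz _]] _].
by rewrite eqxx (eq_sym y x) (negbTE xy) eqxx => e; rewrite e eqxx in xz.
Qed.

Variables (R : realType) (h : V -> R).

(** Half the sum over ordered pairs gives an unordered edge the height difference of its ends,
    without choosing an order on them. *)
Definition height_len (A : {set V}) : R := \sum_(x in A) \sum_(y in A) `|h x - h y| / 2.

Lemma height_lenE x y : height_len [set x; y] = `|h x - h y|.
Proof.
rewrite /height_len; have [->|nxy] := eqVneq x y.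
  by rewrite finset.setUid !big_set1 subrr normr0 mul0r.
have nxy' : x \notin [set y] by rewrite in_set1.
rewrite !(big_setU1 _ nxy') /= !big_set1 /= !(big_setU1 _ nxy') /= !big_set1 !subrr normr0.
rewrite (distrC (h y)); lra.
Qed.

Lemma height_len_ge0 : length_function (G := parent_graph) height_len.
Proof.
by move=> A _; apply: sumr_ge0 => x _; apply: sumr_ge0 => y _; rewrite divr_ge0.
Qed.

End ForestGraph.

Section TreeMetric.
Variables (R : realType) (V : finType) (e : rel V) (w : V -> V -> R).
Variables (p : V -> V) (h : V -> R).
Hypothesis w_ge0 : forall x y, e x y -> 0 <= w x y.
Hypothesis dom : forall g x, lip e w [set: V] g -> `|g x - g (p x)| <= h x - h (p x).

Notation G := (parent_graph p).
Notation tree_dist := (path_dist (G := G) (height_len h)).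

Let h_mono x : h (p x) <= h x.
Proof.
have := dom (g := fun=> 0) x; rewrite subrr normr0 subr_ge0; apply.
by move=> y z _ _ /w_ge0; rewrite subrr.
Qed.

Lemma tree_dist_lip g (x y : G) : lip e w [set: V] g -> ((g y - g x)%:E <= tree_dist x y)%E.
Proof.
move=> lg; apply: path_dist_ge => q + <-; rewrite lee_fin.
elim: q x => [|z q IHq] x /=; first by rewrite subrr walk_length_nil.
case/andP=> axz /IHq le; rewrite walk_length_cons height_lenE.
suff : g z - g x <= `|h x - h z| by lra.
case/andP: axz => _ /orP[/eqP<-|/eqP<-].
  by apply: le_trans (ler_norm _) _; rewrite distrC [leRHS]ger0_norm ?subr_ge0 ?h_mono ?dom.
by apply: le_trans (ler_norm _) _; rewrite [leRHS]distrC [leRHS]ger0_norm ?subr_ge0 ?h_mono ?dom.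
Qed.

Hypothesis cG : connected_graph G.

Lemma tree_dist_anc (x z : G) : fconnect p x z -> (tree_dist x z <= (h x - h z)%:E)%E.
Proof.
move=> /iter_findex <-; move: (findex p x z) => n.
elim: n x => [|n IHn] x; first by rewrite /= subrr path_distxx //; exact: height_len_ge0.
rewrite iterSr; have [epx|npx] := eqVneq (p x) x; first by rewrite epx.
have apx : adj (s := G) x (p x) by rewrite /adj /= /parent_adj eq_sym npx eqxx.
apply: le_trans (path_dist_triangle (@height_len_ge0 _ _ _ _) cG x (p x) _) _.
have := leeD (path_dist_adj (height_len h : {set G} -> R) apx) (IHn (p x)).
by rewrite height_lenE ger0_norm ?subr_ge0 // -EFinD addrA subrK.
Qed.

Lemma tree_dist_le (x y z : G) : fconnect p x z -> fconnect p y z ->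
  (tree_dist x y <= (h x + h y - h z *+ 2)%:E)%E.
Proof.
move=> /tree_dist_anc xz /tree_dist_anc yz.
apply: le_trans (path_dist_triangle (@height_len_ge0 _ _ _ _) cG x z y) _.
have := leeD xz yz; rewrite (path_dist_sym (height_len h : {set G} -> R) y) -EFinD.
by rewrite (_ : h x - h z + (h y - h z) = h x + h y - h z *+ 2) //; lra.
Qed.

End TreeMetric.

(* Connectedness of G rules out infinite distances: a metric with two points at
   infinite distance has no non-contracting map into a metric supported on a
   (connected) tree. *)
Theorem corollary1p6 (R : realType) (T : sgraph) :
  trees T ->
  embeds_into R (fun G => connected_graph G /\ excluding T G) trees.
Proof.
move=> treeT; have [D D0 approx] := tree_approx_interval_rep R #|T|.
(* [D] is only known to be nonnegative; the added 1 makes the constant [c] below positive, so that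
   it can be divided by. *)
exists (D + 1) => X [e [e_sym [e_irr [[cG exG] [len [len0 distE]]]]]].
have [l [r rep]] := excluding_tree_interval_rep treeT exG.
pose G := SGraph e_sym e_irr.
pose w (x y : X) := len [set x; y].
have w_sym x y : w x y = w y x by rewrite /w finset.setUC.
have w_ge0 x y : e x y -> 0 <= w x y by move=> exy; exact: (len_adj_ge0 len0 (x := x : G) exy).
have [I [p [rk [h [b [I_gt0 fp dom anc expb]]]]]] := approx _ e w e_sym w_sym w_ge0 _ l r rep.
have {}dom i g x : lip e w [set: X] g -> `|g x - g (p i x)| <= h i x - h i (p i x).
  by move=> lg; apply: dom => //; rewrite finset.in_setT.
have {}anc i x y : e x y -> exists z,
    [/\ fconnect (p i) x z, fconnect (p i) y z & h i x + h i y - h i z *+ 2 <= b i x y].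
  by apply: anc; rewrite finset.in_setT.
have {}expb x y : e x y -> \sum_i b i x y <= D * w x y * #|I|%:R.
  by apply: expb; rewrite finset.in_setT.
(* Adjacent vertices share an ancestor, so connectedness of [G] makes each forest a single tree. *)
have cT i : connected_graph (parent_graph (p i)).
  move=> x y; have := cG x y; apply: connect_sub => {}x {}y exy.
  have [z [xz yz _]] := anc i x y exy; apply: connect_trans (fconnect_parent_adj xz) _.
  by rewrite (sym_connect_sym (@parent_adj_sym _ (p i))); exact: fconnect_parent_adj.
(* The distance from [x] is the test function that turns domination of all [g] into
   non-contraction. *)
have pd_lip (x : G) : lip e w [set: X] (fun v => fine (path_dist len x (v : G))).
  move=> u v _ _ euv; rewrite lerBlDl -lee_fin EFinD !fineK ?path_dist_fin //.
  apply: le_trans (path_dist_triangle len0 cG x v u) _; rewrite leeD2l // w_sym.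
  by apply: path_dist_adj; rewrite adj_sym.
pose Y i := path_metric (@height_len_ge0 _ (p i) R (h i)) (cT i).
have i0 : I by move: I_gt0 => /card_gt0P/sigW[].
(* Numbers beyond [#|I|] have probability 0, but must still be sent to some tree; [i0] is that
   default. *)
pose f n := nth i0 (enum I) n.
have [P PE] := uniform_probability R I_gt0.
exists _, nat, P, (fun n => Y (f n)), (fun n (x : X) => (x : Y (f n))); split.
- move=> n; exists (parent_adj (p (f n))), (@parent_adj_sym _ _), (@parent_adj_irr _ _).
  split; first by split; [exact: cT|exact: parent_graph_acyclic (fp (f n))].
  by exists (height_len (h (f n))); split=> //; exact: height_len_ge0.
- by [].
- apply: aeW => n x y; rewrite distE.
  have xx : fine (path_dist len (x : G) x) = 0 by rewrite (path_distxx len0).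
  have := tree_dist_lip (p := p (f n)) w_ge0 (dom (f n)) x y (pd_lip x).
  by rewrite xx subr0 fineK // path_dist_fin.
- move=> x y; rewrite PE => [|n]; last exact: dist_ge0.
  have dfin i (u v : Y i) : dist u v \is a fin_num.
    exact: (path_dist_fin (@height_len_ge0 _ _ _ _) (cT i)).
  have -> : (\sum_(n < #|I|) dist (x : Y (f n)) (y : Y (f n)))%E =
      (\sum_i fine (dist (x : Y i) (y : Y i)))%:E.
    rewrite -sumEFin -[RHS]big_enum /= (big_nth i0) -cardE big_mkord.
    by apply: eq_bigr => n _; rewrite fineK //; exact: (dfin (f n)).
  pose c : R := (D + 1) * #|I|%:R.
  have I0 : 0 < #|I|%:R :> R by rewrite ltr0n.
  have c0 : 0 < c by rewrite mulr_gt0 //; lra.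
  have walk_le q (u : G) : path (@adj G) u q ->
      \sum_i fine (dist (u : Y i) (last u q : Y i)) <= c * walk_length len u q.
    elim: q u => [|v q IHq] u.
      by move=> _; rewrite walk_length_nil mulr0 big1 // => i _; rewrite distxx.
    case/andP=> auv /IHq le; rewrite walk_length_cons mulrDr [last _ _]/=.
    apply: (@le_trans _ _ (\sum_i (b i u v + fine (dist (v : Y i) (last v q))))).
      apply: ler_sum => i _; rewrite -lee_fin EFinD !fineK //.
      apply: le_trans (dist_triangle (u : Y i) v _) _; rewrite leeD2r //.
      have [z [uz vz leb]] := anc i u v auv.
      exact: le_trans (tree_dist_le w_ge0 (dom i) (cT i) uz vz) _.
    rewrite big_split lerD //= (le_trans (expb _ _ auv)) // /c.
    have := mulr_ge0 (w_ge0 _ _ auv) (ltW I0); rewrite /w; lra.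
  (* Dividing by [c] makes the left side a lower bound for the length of every walk, hence for their
     infimum. *)
  have : (((\sum_i fine (dist (x : Y i) (y : Y i))) / c)%:E <= dist x y)%E.
    rewrite distE; apply: path_dist_ge => q pq lq.
    by rewrite lee_fin ler_pdivrMr // mulrC -lq walk_le.
  rewrite distE -(fineK (path_dist_fin len0 cG x y)) lee_fin ler_pdivrMr // => le.
  rewrite -!EFinM lee_fin ler_pdivrMl //; apply: le_trans le _.
  by rewrite /c; lra.
Qed.
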